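(* Let $f\in L^{0}(\mathbb{T})$ and $\epsilon>0$. Then there is a decomposition $$f=g+h,\qquad g\in\mathrm{PLA},\quad h\in C(\mathbb{T}),\quad \|h\|_{C(\mathbb{T})}<\epsilon ,$$ where equality is understood almost everywhere.
   Context: $\mathbb{T}=\mathbb{R}/2\pi\mathbb{Z}$ is the circle. $L^{0}(\mathbb{T})$ is the space of (Lebesgue) measurable functions $f:\mathbb{T}\to\mathbb{C}$, with functions equal almost everywhere identified. $\|h\|_{C(\mathbb{T})}=\sup_{t\in\mathbb{T}}|h(t)|$. A function $g$ on $\mathbb{T}$ belongs to $\mathrm{PLA}$ (pointwise limits of analytic sums) if there are complex coefficients $c(n)$, $n\ge 0$, such that the series $\sum_{n\geq 0}c(n)e^{int}$ converges to $g(t)$ for almost every $t\in\mathbb{T}$. The coefficients $c(n)$ are not required to be Fourier coefficients of $g$. *)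

(* Defs.v *)
From HB Require Import structures.
From mathcomp Require Import all_boot all_order all_algebra.
From mathcomp Require Import all_classical all_reals all_analysis.
From mathcomp Require Import measurable_realfun complex.
Import Order.TTheory GRing.Theory Num.Theory.
Import numFieldNormedType.Exports.

Set Implicit Arguments.
Unset Strict Implicit.
Unset Printing Implicit Defensive.

Local Open Scope classical_set_scope.
Local Open Scope ring_scope.

(* R[i] carries no topology by default: give it that of its modulus, which the
   library puts on any numFieldType viewed as a normed module over itself. *)
#[warnings="-redundant-canonical-projection"]
HB.instance Definition _ (R : rcfType) := NormedModule.copy R[i] (R[i])^o.

(* R with the sigma-algebra of Lebesgue (not only Borel) measurable sets. *)
Definition lebesgueType (R : realType) :=
  g_sigma_algebraType (completed_algebra_gen (@lebesgue_measure R)).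

Definition borelC (R : realType) := g_sigma_algebraType (@open R[i]).

(* A function on the circle R/2piZ is a 2pi-periodic function on R; a subset of
   the circle is null iff its 2pi-periodic preimage in R is Lebesgue null. *)
Definition circle_fun (R : realType) (f : R -> R[i]) : Prop :=
  periodic f (pi *+ 2).

(* Representatives of the elements of L^0; the identification of functions that
   agree almost everywhere is made where the elements are compared. *)
Definition L0 (R : realType) (f : R -> R[i]) : Prop :=
  circle_fun f /\ measurable_fun setT (f : lebesgueType R -> borelC R).

Definition continuous_circle (R : realType) (h : R -> R[i]) : Prop :=
  circle_fun h /\ continuous h.

(* The modulus on R[i] itself takes values in R[i]; Normc.normc is the same
   modulus with values in R. *)
Definition supnorm (R : realType) (h : R -> R[i]) : \bar R :=
  ereal_sup (range (fun t : R => (Normc.normc (h t))%:E)).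

Definition expi (R : realType) (t : R) : R[i] := Complex (cos t) (sin t).

Definition PLA (R : realType) (g : R -> R[i]) : Prop :=
  circle_fun g /\
  exists c : nat -> R[i],
    {ae (@lebesgue_measure R), forall t : R,
      series (fun n : nat => c n * expi (n%:R * t)) @ \oo --> g t}.

(* Main.v *)
(** Analytic polynomials P_k and small continuous h_k with f = sum (P_k + h_k) are
    chosen one after the other, with increasing disjoint spectra, so that the
    partial sums of sum P_k converge almost everywhere to f - sum h_k.

    Let p be a trigonometric polynomial close to the continuous residual.  One
    looks for P = p (1 - G) with G small off a small set: then p - P = p G, and the
    part of it that is small in modulus is handed over to h, so the new residual
    vanishes off a small set.  G is the end of a complex random walk of Brownian
    type (a Hardy martingale), run until it falls near 0; this happens with
    probability close to 1 because planar Brownian motion is neighbourhood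
    recurrent.  Starting from G = 1, one sets G' = G (1 + psi z^N r(z^N)) with
    z = e^(it), N huge, r a flat polynomial and psi >= 0 a trigonometric polynomial
    in |G|^2 that vanishes where |G| = a or |G| = b; so a <= |G| <= b persists.
    The new frequencies being all large, P stays analytic although p and psi are
    not.  The integral of |G|^2 grows by that of |G psi|^2 and is bounded by
    2 pi b^2, so |G psi| gets small in mean: |G| is close to a or to b off a small
    set.  The integral of log |G|^2 stays almost 0, which forces |G| to be
    close to b only on a small set.

    The bound on the partial sums of P is proportional to |p|, with a factor that
    depends only on sup |p| and on the precision; so they are small where the
    residual vanishes, and Borel-Cantelli concludes. *)

Require Import Defs.
From mathcomp Require Import all_boot all_order all_algebra.
From mathcomp Require Import all_classical all_reals all_analysis.
From mathcomp Require Import measurable_realfun complex.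
From mathcomp Require Import ring lra zify.
Import Order.TTheory GRing.Theory Num.Theory.
Import numFieldNormedType.Exports.

Set Implicit Arguments.
Unset Strict Implicit.
Unset Printing Implicit Defensive.

Local Open Scope classical_set_scope.
Local Open Scope ring_scope.

Local Notation nm := Normc.normc.
Local Notation Re := complex.Re.
Local Notation Im := complex.Im.
Local Notation "x %:C" := (real_complex _ x) (format "x %:C").

(** * Arithmetic of the real-valued modulus and of [expi] *)

Section Modulus.
Context {R : realType}.
Implicit Types (z w : R[i]) (x : R).

Lemma ReD z w : Re (z + w) = Re z + Re w. Proof. by case: z w => a b []. Qed.
Lemma ImD z w : Im (z + w) = Im z + Im w. Proof. by case: z w => a b []. Qed.
Lemma ReM z w : Re (z * w) = Re z * Re w - Im z * Im w.
Proof. by case: z w => a b []. Qed.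
Lemma ImM z w : Im (z * w) = Re z * Im w + Im z * Re w.
Proof. by case: z w => a b []. Qed.
Lemma ReN z : Re (- z) = - Re z. Proof. by case: z. Qed.
Lemma ImN z : Im (- z) = - Im z. Proof. by case: z. Qed.

Lemma Re_conj z : Re (conjc z) = Re z. Proof. by case: z. Qed.
Lemma Im_conj z : Im (conjc z) = - Im z. Proof. by case: z. Qed.
Lemma nmE z : nm z = Num.sqrt (Re z ^+ 2 + Im z ^+ 2). Proof. by case: z. Qed.

Lemma nmD z w : nm (z + w) <= nm z + nm w. Proof. exact: le_normcD. Qed.
Lemma nmN z : nm (- z) = nm z. Proof. exact: normcN. Qed.
Lemma nmM z w : nm (z * w) = nm z * nm w. Proof. exact: Normc.normcM. Qed.
Lemma nm1 : nm 1 = 1 :> R. Proof. exact: Normc.normc1. Qed.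
Lemma nm0 : nm 0 = 0 :> R. Proof. exact: Normc.normc0. Qed.
Lemma nm_ge0 z : 0 <= nm z. Proof. by case: z => a b /=; exact: sqrtr_ge0. Qed.
Lemma nm_eq0 z : (nm z == 0) = (z == 0).
Proof. by apply/eqP/eqP => [/Normc.eq0_normc//|->]; exact: nm0. Qed.
Lemma nmX z n : nm (z ^+ n) = nm z ^+ n.
Proof. by elim: n => [|n IH]; rewrite ?expr0 ?nm1// !exprS nmM IH. Qed.
Lemma nmR x : nm x%:C = `|x|.
Proof. by rewrite /= expr0n/= addr0 sqrtr_sqr. Qed.
Lemma nmB z w : nm (z - w) <= nm z + nm w.
Proof. by rewrite -(nmN w) nmD. Qed.
Lemma nm_sym z w : nm (z - w) = nm (w - z).
Proof. by rewrite -nmN opprB. Qed.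
Lemma ler_nmB z w : nm z - nm w <= nm (z - w).
Proof. by rewrite lerBlDr -{1}(subrK w z) nmD. Qed.
Lemma nm_sqr z : nm z ^+ 2 = Re z ^+ 2 + Im z ^+ 2.
Proof. by case: z => a b /=; rewrite sqr_sqrtr// addr_ge0 ?sqr_ge0. Qed.
Lemma nm_sqrC z : (nm z ^+ 2)%:C = z * conjc z.
Proof.
rewrite nm_sqr; case: z => a b; apply/eqP; rewrite eq_complex /=.
by apply/andP; split; apply/eqP; ring.
Qed.
Lemma conjcM z w : conjc (z * w) = conjc z * conjc w.
Proof. exact: rmorphM. Qed.
Lemma conjcX z n : conjc (z ^+ n) = conjc z ^+ n.
Proof. exact: rmorphXn. Qed.
Lemma ReZ x z : Re (x%:C * z) = x * Re z.
Proof. by rewrite ReM /= mul0r subr0. Qed.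
Lemma nm_sqrD z w :
  nm (z + w) ^+ 2 = nm z ^+ 2 + nm w ^+ 2 + 2 * Re (conjc z * w).
Proof. by rewrite !nm_sqr ReD ImD ReM Re_conj Im_conj; ring. Qed.
Lemma nm_Re z : `|Re z| <= nm z.
Proof.
rewrite -(ler_pXn2r (n := 2))// ?nnegrE ?nm_ge0// nm_sqr real_normK ?num_real//.
by rewrite lerDl sqr_ge0.
Qed.
Lemma nm_Im z : `|Im z| <= nm z.
Proof.
rewrite -(ler_pXn2r (n := 2))// ?nnegrE ?nm_ge0// nm_sqr real_normK ?num_real//.
by rewrite lerDr sqr_ge0.
Qed.
Lemma nm_sum (J : Type) (s : seq J) (P : pred J) (F : J -> R[i]) :
  nm (\sum_(j <- s | P j) F j) <= \sum_(j <- s | P j) nm (F j).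
Proof.
elim/big_rec2: _ => [|j y x _ le_xy]; first by rewrite nm0.
by apply: le_trans (nmD _ _) _; rewrite lerD2l.
Qed.
Lemma nm_ReIm z : nm z <= `|Re z| + `|Im z|.
Proof.
rewrite -(ler_pXn2r (n := 2))// ?nnegrE ?nm_ge0 ?addr_ge0// nm_sqr sqrrD.
by rewrite !real_normK ?num_real// lerD2r lerDl mulrn_wge0// mulr_ge0.
Qed.

Lemma nm_expi (t : R) : nm (expi t) = 1.
Proof. by rewrite /= cos2Dsin2 sqrtr1. Qed.
Lemma expiD (s t : R) : expi (s + t) = expi s * expi t.
Proof.
by apply/eqP; rewrite eq_complex /= cosD sinD eqxx/= addrC [sin s * _]mulrC [X in _ + X]mulrC mulrC.
Qed.
Lemma expi0 : expi (0 : R) = 1.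
Proof. by apply/eqP; rewrite eq_complex /= cos0 sin0 !eqxx. Qed.
Lemma expiMn n (t : R) : expi (n%:R * t) = expi t ^+ n.
Proof.
elim: n => [|n IH]; first by rewrite mul0r expi0 expr0.
by rewrite -natr1 mulrDl mul1r expiD IH exprSr.
Qed.
Lemma expi_neq0 (t : R) : expi t != 0.
Proof. by rewrite -nm_eq0 nm_expi oner_eq0. Qed.
Lemma expi_unitX (t : R) n : expi t ^+ n != 0.
Proof. by rewrite expf_neq0// expi_neq0. Qed.
Lemma nm_expiX (t : R) n : nm (expi t ^+ n) = 1.
Proof. by rewrite nmX nm_expi expr1n. Qed.
Lemma expi_conj (t : R) : conjc (expi t) = (expi t)^-1.
Proof.
apply: (mulfI (expi_neq0 t)); rewrite divff ?expi_neq0// -nm_sqrC nm_expi.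
by rewrite expr1n.
Qed.
Lemma expi_2pi (t : R) : expi (t + pi *+ 2) = expi t.
Proof.
by apply/eqP; rewrite eq_complex /= (cosD2pi t) (sinD2pi t) !eqxx.
Qed.

End Modulus.

(** * Componentwise continuity of complex functions *)

Section ComplexContinuity.
Context {R : realType}.
Implicit Types (F G : R -> R[i]).

(** Componentwise, so that real calculus applies; [ccont_continuous] goes back to the topology of
    [R[i]]. *)
Definition ccont F :=
  continuous (fun t => Re (F t)) /\ continuous (fun t => Im (F t)).

Lemma ccont_cst c : ccont (fun=> c).
Proof. by split=> t; exact: cvg_cst. Qed.
Lemma ccontD F G : ccont F -> ccont G -> ccont (fun t => F t + G t).
Proof.
move=> [Fr Fi] [Gr Gi]; split.
  rewrite (funext (fun t => ReD (F t) (G t))) => t.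
  exact: (cvgD (Fr t) (Gr t)).
rewrite (funext (fun t => ImD (F t) (G t))) => t.
exact: (cvgD (Fi t) (Gi t)).
Qed.
Lemma ccontN F : ccont F -> ccont (fun t => - F t).
Proof.
move=> [Fr Fi]; split.
  by rewrite (funext (fun t => ReN (F t))) => t; exact: (cvgN (Fr t)).
by rewrite (funext (fun t => ImN (F t))) => t; exact: (cvgN (Fi t)).
Qed.
Lemma ccontB F G : ccont F -> ccont G -> ccont (fun t => F t - G t).
Proof. by move=> cF cG; apply: ccontD => //; exact: ccontN. Qed.
Lemma ccontM F G : ccont F -> ccont G -> ccont (fun t => F t * G t).
Proof.
move=> [Fr Fi] [Gr Gi]; split.
  rewrite (funext (fun t => ReM (F t) (G t))) => t.
  exact: (cvgB (cvgM (Fr t) (Gr t)) (cvgM (Fi t) (Gi t))).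
rewrite (funext (fun t => ImM (F t) (G t))) => t.
exact: (cvgD (cvgM (Fr t) (Gi t)) (cvgM (Fi t) (Gr t))).
Qed.
Lemma ccont_conj F : ccont F -> ccont (fun t => conjc (F t)).
Proof.
move=> [Fr Fi]; split.
  by rewrite (funext (fun t => Re_conj (F t))).
by rewrite (funext (fun t => Im_conj (F t))) => t; exact: (cvgN (Fi t)).
Qed.
Lemma ccont_real (u : R -> R) : continuous u -> ccont (fun t => (u t)%:C).
Proof. by move=> cu; split=> //= t; exact: cvg_cst. Qed.
Lemma ccontX F n : ccont F -> ccont (fun t => F t ^+ n).
Proof.
move=> cF; elim: n => [|n IH].
  by under eq_fun do rewrite expr0; exact: ccont_cst.
by under eq_fun do rewrite exprS; exact: ccontM.
Qed.
Lemma ccont_expi : ccont (@expi R).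
Proof. by split=> t; [exact: continuous_cos|exact: continuous_sin]. Qed.
Lemma ccont_poly F (q : {poly R[i]}) : ccont F -> ccont (fun t => q.[F t]).
Proof.
move=> cF; elim/poly_ind: q => [|q c IH].
  by under eq_fun do rewrite horner0; exact: ccont_cst.
under eq_fun do rewrite hornerMXaddC.
by apply: ccontD; [exact: ccontM|exact: ccont_cst].
Qed.
Lemma ccont_nm F : ccont F -> continuous (fun t => nm (F t)).
Proof.
move=> [Fr Fi]; rewrite (funext (fun t => nmE (F t))) => t.
apply: (@continuous_comp _ _ _ (fun s => Re (F s) ^+ 2 + Im (F s) ^+ 2)
  (@Num.sqrt R)); last exact: sqrt_continuous.
exact: (cvgD (cvgM (Fr t) (Fr t)) (cvgM (Fi t) (Fi t))).
Qed.

End ComplexContinuity.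

(** * Integrals over a period and vanishing means *)

Section PeriodMean.
Context {R : realType}.
Local Notation mu := (@lebesgue_measure R).
Implicit Types (u v : R -> R).

Definition intT (u : R -> R) : R := \int[mu]_(t in `[0, pi *+ 2]) u t.

Lemma twopi_gt0 : 0 < pi *+ 2 :> R.
Proof. by rewrite mulrn_wgt0// pi_gt0. Qed.

Lemma integrableT u : continuous u -> mu.-integrable `[0, pi *+ 2] (EFin \o u).
Proof.
move=> cu; apply: continuous_compact_integrable; first exact: segment_compact.
exact: continuous_subspaceT.
Qed.

Lemma intTD u v : continuous u -> continuous v ->
  intT (fun t => u t + v t) = intT u + intT v.
Proof. by move=> cu cv; apply: RintegralD => //; exact: integrableT. Qed.
Lemma intTZ c u : continuous u -> intT (fun t => c * u t) = c * intT u.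
Proof. by move=> cu; apply: RintegralZl => //; exact: integrableT. Qed.
Lemma le_intT u v : continuous u -> continuous v -> (forall t, u t <= v t) ->
  intT u <= intT v.
Proof. by move=> cu cv uv; apply: le_Rintegral => //; exact: integrableT. Qed.
Lemma intT_cst c : intT (fun=> c) = c * (pi *+ 2).
Proof.
rewrite /intT Rintegral_cst//=; congr (_ * _).
rewrite lebesgue_measure_itv/= lte_fin twopi_gt0/=.
by rewrite subr0.
Qed.

Lemma intT_expiX (c : R[i]) n : intT (fun t => Re (c * expi t ^+ n.+1)) = 0.
Proof.
pose k : R := n.+1%:R.
have k0 : k != 0 by rewrite pnatr_eq0.
(* An antiderivative; being periodic, it takes equal values at 0 and [pi *+ 2]. *)
pose H t : R := (Re c * sin (k * t) + Im c * cos (k * t)) / k.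
have dH (t : R) : is_derive t 1 H (Re (c * expi t ^+ n.+1)).
  rewrite -expiMn ReM /= -/k /H.
  have dm : is_derive t 1 (fun t : R => k * t) k.
    by apply: is_derive_eq; rewrite /GRing.scale/= mulr1.
  have ds : is_derive t 1 (fun t : R => sin (k * t)) (cos (k * t) * k).
    by apply: (is_derive1_comp (f := @sin R)).
  have dc : is_derive t 1 (fun t : R => cos (k * t)) (- sin (k * t) * k).
    by apply: (is_derive1_comp (f := @cos R)).
  have -> : (fun t : R => (Re c * sin (k * t) + Im c * cos (k * t)) / k) =
    (k^-1 \*: ((Re c \*: (fun t : R => sin (k * t)))
             + (Im c \*: (fun t : R => cos (k * t)))))%R.
    by apply/funext => s /=; rewrite mulrC.
  apply: is_derive_eq; rewrite /GRing.scale/=.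
  by field.
have cf : continuous (fun t : R => Re (c * expi t ^+ n.+1)).
  by apply: (ccontM (ccont_cst _) (ccontX _ ccont_expi)).1.
rewrite /intT /Rintegral (@continuous_FTC2 _ _ H)//.
- rewrite /= /H mulr0 sin0 cos0.
  have -> : k * (pi *+ 2) = 0 + pi *+ 2 *+ n.+1 by rewrite add0r mulr_natl.
  by rewrite (periodicn (@sinD2pi R)) (periodicn (@cosD2pi R)) sin0 cos0 subrr.
- exact: twopi_gt0.
- exact: continuous_subspaceT.
- have cH : continuous H.
    move=> t; apply/differentiable_continuous/derivable1_diffP.
    by have [] := dH t.
  split.
  + by move=> x _; have [] := dH x.
  + exact/cvg_at_right_filter/cH.
  + exact/cvg_at_left_filter/cH.
- by move=> x _; rewrite derive1E; have /@derive_val := dH x.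
Qed.

Lemma intT_analytic (q : {poly R[i]}) n :
  intT (fun t => Re (expi t ^+ n.+1 * q.[expi t])) = 0.
Proof.
elim/poly_ind: q n => [|q c IH] n.
  under [X in intT X]eq_fun do rewrite horner0 mulr0.
  by rewrite intT_cst mul0r.
under [X in intT X]eq_fun do
  rewrite hornerMXaddC mulrDr (mulrC q.[_]) mulrA -exprSr ReD [X in _ + Re X]mulrC.
rewrite intTD ?IH ?intT_expiX ?addr0//.
  apply: (ccontM (ccontX _ ccont_expi) (ccont_poly _ ccont_expi)).1.
by apply: (ccontM (ccont_cst _) (ccontX _ ccont_expi)).1.
Qed.

End PeriodMean.

(** * Trigonometric polynomials and their negative frequencies *)

Section TrigPolynomials.
Context {R : realType}.
Implicit Types (F G : R -> R[i]) (q : {poly R[i]}) (w : R[i]).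

(** On the unit circle conjugation is inversion, which reverses the coefficients. As [s] exceeds the
    degree of [q], only positive powers remain, whence the factor [w] on the right. *)
Lemma conj_polyE q s : (size q <= s)%N ->
  exists q', forall w, nm w = 1 -> w ^+ s * conjc q.[w] = w * q'.[w].
Proof.
move=> qs; exists (\sum_(i < s) (conjc q`_i) *: 'X^(s.-1 - i)) => w w1.
have w0 : w != 0 by rewrite -nm_eq0 w1 oner_eq0.
have wJ : conjc w = w^-1.
  by apply: (mulfI w0); rewrite divff// -nm_sqrC w1 expr1n.
rewrite (horner_coef_wide _ qs) rmorph_sum/= horner_sum !mulr_sumr.
apply: eq_bigr => i _; rewrite hornerZ hornerXn rmorphM rmorphXn/= wJ exprVn.
rewrite mulrCA [RHS]mulrCA; congr (_ * _).
have -> : w ^+ s = w ^+ i * w ^+ (s.-1 - i).+1.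
  by rewrite -exprD; congr (_ ^+ _); have := ltn_ord i; lia.
by rewrite [w ^+ i * _]mulrC mulfK ?expf_neq0// exprS.
Qed.

(* The degree bound d need not be sharp, and q may have any size: only the
   negative frequencies have to be controlled. *)
Definition trigpoly F := exists d q, forall t, expi t ^+ d * F t = q.[expi t].

Lemma trigpoly_horner q : trigpoly (fun t => q.[expi t]).
Proof. by exists 0%N, q => t; rewrite expr0 mul1r. Qed.
Lemma trigpoly_cst c : trigpoly (fun=> c).
Proof. by exists 0%N, c%:P => t; rewrite expr0 mul1r hornerC. Qed.
Lemma trigpolyM F G : trigpoly F -> trigpoly G -> trigpoly (fun t => F t * G t).
Proof.
move=> [d [p Fp]] [e [q Gq]]; exists (d + e)%N, (p * q) => t.
by rewrite hornerM -Fp -Gq exprD mulrACA.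
Qed.
Lemma trigpolyD F G : trigpoly F -> trigpoly G -> trigpoly (fun t => F t + G t).
Proof.
move=> [d [p Fp]] [e [q Gq]]; exists (d + e)%N, ('X^e * p + 'X^d * q) => t.
rewrite hornerD !hornerM !hornerXn -Fp -Gq exprD; ring.
Qed.
Lemma trigpolyN F : trigpoly F -> trigpoly (fun t => - F t).
Proof.
by move=> [d [p Fp]]; exists d, (- p) => t; rewrite hornerN -Fp mulrN.
Qed.
Lemma trigpolyB F G : trigpoly F -> trigpoly G -> trigpoly (fun t => F t - G t).
Proof. by move=> tF tG; apply: trigpolyD => //; exact: trigpolyN. Qed.
Lemma trigpoly_conj F : trigpoly F -> trigpoly (fun t => conjc (F t)).
Proof.
move=> [d [p Fp]]; have [q pq] := conj_polyE (leqnn (size p)).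
exists (size p), ('X^d * ('X * q)) => t.
have -> : ('X^d * ('X * q)).[expi t] = expi t ^+ d * (expi t * q.[expi t]).
  by rewrite !hornerM hornerXn hornerX.
rewrite -pq ?nm_expi// -Fp conjcM conjcX expi_conj exprVn.
by rewrite [RHS]mulrCA mulVKf// expi_unitX.
Qed.
Lemma trigpoly_eq F G : F =1 G -> trigpoly F -> trigpoly G.
Proof. by move=> FG [d [p Fp]]; exists d, p => t; rewrite -FG. Qed.

Lemma trigpoly_sum (J : Type) (s : seq J) (F : J -> R -> R[i]) :
  (forall j, trigpoly (F j)) -> trigpoly (fun t => \sum_(j <- s) F j t).
Proof.
move=> tF; elim: s => [|j s IH].
  by apply: trigpoly_eq (trigpoly_cst 0) => t; rewrite big_nil.
by apply: trigpoly_eq (trigpolyD (tF j) IH) => t; rewrite big_cons.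
Qed.

Lemma trigpolyE F d q : (forall t, expi t ^+ d * F t = q.[expi t]) ->
  F = fun t => (expi t)^-1 ^+ d * q.[expi t].
Proof.
by move=> Fq; apply/funext => t; rewrite -Fq exprVn mulKf// expi_unitX.
Qed.

Lemma ccont_trigpoly F : trigpoly F -> ccont F.
Proof.
move=> [d [q /trigpolyE ->]].
apply: ccontM; last exact: ccont_poly ccont_expi.
apply: ccontX; rewrite (_ : (fun t => _) = (fun t => conjc (expi t))).
  exact: ccont_conj ccont_expi.
by apply/funext => t; rewrite expi_conj.
Qed.

Lemma trigpoly_periodic F : trigpoly F -> circle_fun F.
Proof. by move=> [d [q /trigpolyE ->]] t; rewrite expi_2pi. Qed.

(** Multiplication by a high power of [expi t] makes all frequencies positive, even those of [F].
    This yields the orthogonality relations of the iteration. *)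
Lemma intT_trigpoly F : trigpoly F -> exists d, forall N W, (d <= N)%N ->
  intT (fun t => Re (F t * (expi t ^+ N * W.[expi t ^+ N]))) = 0.
Proof.
(* One more than [d], so that frequency 0 is excluded too. *)
move=> [d [q Fq]]; exists d.+1 => N W dN.
rewrite -[RHS](intT_analytic (q * (W \Po 'X^N)) (N - d.+1)); congr intT.
apply/funext => t; congr Re; rewrite hornerM horner_comp hornerXn -Fq.
have -> : expi t ^+ N = expi t ^+ d * expi t ^+ (N - d.+1).+1.
  by rewrite -exprD; congr (_ ^+ _); lia.
ring.
Qed.

End TrigPolynomials.

(** * Flat polynomials with bounded partial sums *)

Section RudinShapiro.
Context {R : realType}.
Implicit Types (q : {poly R[i]}) (w : R[i]).

Fixpoint rudin_shapiro k : {poly R[i]} * {poly R[i]} :=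
  if k is k'.+1 then
    let: (p, q) := rudin_shapiro k' in
    (p + 'X^(2 ^ k') * q, p - 'X^(2 ^ k') * q)
  else (1, 1).

Lemma take_poly_addXn (p q : {poly R[i]}) m n : (size p <= m)%N ->
  take_poly n (p + 'X^m * q) =
  if (n <= m)%N then take_poly n p else p + 'X^m * take_poly (n - m) q.
Proof.
move=> pm; apply/polyP => i; rewrite coef_take_poly coefD coefXnM.
case: (leqP n m) => nm0; last rewrite coefD coefXnM coef_take_poly.
  rewrite coef_take_poly; case: (ltnP i n) => // in_.
  by rewrite (leq_trans in_ nm0) addr0.
case: (ltnP i m) => im; first by rewrite (ltn_trans im nm0).
rewrite ltn_sub2rE//; case: (ltnP i n) => // _.
by rewrite nth_default ?addr0// (leq_trans pm).
Qed.

(** The parallelogram law doubles the sum of the squares. A truncation falls in the first half, or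
    leaves it whole, of modulus at most [Num.sqrt 2 ^+ k.+1], and cuts the second half. *)
Lemma rudin_shapiro_spec k : let: (p, q) := rudin_shapiro k in
  [/\ (size p <= 2 ^ k)%N /\ (size q <= 2 ^ k)%N,
    forall i, nm p`_i <= 1 /\ nm q`_i <= 1,
    forall w, nm w = 1 -> nm p.[w] ^+ 2 + nm q.[w] ^+ 2 = 2 ^+ k.+1 &
    forall w n, nm w = 1 ->
      nm (take_poly n p).[w] <= 4 * Num.sqrt 2 ^+ k /\
      nm (take_poly n q).[w] <= 4 * Num.sqrt 2 ^+ k].
Proof.
pose s : R := Num.sqrt 2.
have s0 : 0 <= s by exact: sqrtr_ge0.
have s2 : s ^+ 2 = 2 by rewrite sqr_sqrtr.
(* Equivalent to [4 + s <= 4 * s], with which the constant 4 survives the induction. *)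
have s43 : 4 / 3 <= s.
  by rewrite -(ler_pXn2r (n := 2))// ?nnegrE// s2; lra.
rewrite -/s; elim: k => [|k] /=.
  rewrite size_poly1; split=> //.
  - by move=> i; rewrite coef1; case: (i == 0)%N; rewrite ?nm1 ?nm0.
  - by move=> w _; rewrite hornerC nm1 expr1n expr1.
  - move=> w n _; rewrite expr0 mulr1.
    suff : nm (take_poly n (1 : {poly R[i]})).[w] <= 1 by lra.
    case: n => [|n]; first by rewrite take_poly0l horner0 nm0.
    by rewrite take_poly_id ?size_poly1// hornerC nm1.
case: (rudin_shapiro k) => p q [[sp sq] c1 pq tk].
have pow2 : (2 ^ k.+1 = 2 ^ k + 2 ^ k)%N by rewrite expnS mul2n addnn.
have szM : (size ('X^(2 ^ k) * q)%R <= 2 ^ k.+1)%N.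
  apply: leq_trans (size_polyMleq _ _) _; rewrite size_polyXn pow2.
  by rewrite addSn /= leq_add2l.
have szp : (size p <= 2 ^ k.+1)%N by rewrite pow2 (leq_trans sp)// leq_addr.
have nmk w n : nm w = 1 -> nm (w ^+ n) = 1 by move=> w1; rewrite nmX w1 expr1n.
split.
- split; apply: leq_trans (size_polyD _ _) _; rewrite ?size_polyN geq_max;
  by rewrite szM szp.
- move=> i; rewrite coefB coefD coefXnM.
  have [[p1 _] [_ q1]] := (c1 i, c1 (i - 2 ^ k)%N).
  case: ltnP => ik; first by rewrite subr0 addr0.
  by rewrite nth_default ?add0r ?nmN ?(leq_trans sp).
- move=> w w1; rewrite [2 ^+ k.+2]exprS -(pq w w1) !hornerD hornerN !hornerM hornerXn.
  have := nmk w (2 ^ k)%N w1; move: (w ^+ _) p.[w] q.[w] => u a b u1.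
  have <- : nm (u * b) = nm b by rewrite nmM u1 mul1r.
  by rewrite !nm_sqr !ReD !ImD !ReN !ImN; ring.
- have bnd w q' n : nm w = 1 -> nm p.[w] <= s ^+ k.+1 ->
      (forall n, nm (take_poly n q').[w] <= 4 * s ^+ k) ->
      nm (take_poly n (p + 'X^(2 ^ k) * q')).[w] <= 4 * s ^+ k.+1.
    move=> w1 ps qs; have sk : 4 * s ^+ k + s ^+ k.+1 <= 4 * s ^+ k.+1.
      by rewrite exprS; have := exprn_ge0 k s0; nra.
    rewrite take_poly_addXn//; case: ifP => _.
      apply: le_trans sk; apply: le_trans (tk w n w1).1 _.
      by rewrite lerDl exprn_ge0.
    rewrite hornerD hornerM hornerXn; apply: le_trans (nmD _ _) _.
    by rewrite nmM nmk// mul1r (le_trans _ sk)// addrC lerD.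
  move=> w n w1; have ps : nm p.[w] <= s ^+ k.+1.
    rewrite -(ler_pXn2r (n := 2))// ?nnegrE ?nm_ge0 ?exprn_ge0//.
    by rewrite -exprM mulnC exprM s2 -(pq w w1) lerDl sqr_ge0.
  split; first by apply: bnd => // m; exact: (tk w m w1).2.
  rewrite -mulrN; apply: bnd => // m.
  by rewrite (raddfN (take_poly m)) hornerN nmN; exact: (tk w m w1).2.
Qed.

(** [r] is a normalised Rudin-Shapiro polynomial [p + 'X^(2 ^ k) * q]. The cross term of its squared
    modulus is the conjugate of [p] times ['X^(2 ^ k) * q], where [conj_polyE] leaves only positive
    frequencies: hence [W]. *)
Lemma flat_poly (eta : R) : 0 < eta -> exists r W : {poly R[i]},
  [/\ forall w n, nm w = 1 -> nm (take_poly n r).[w] <= 4,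
      forall i, nm r`_i <= eta &
      forall w, nm w = 1 -> nm r.[w] ^+ 2 = 1 + 2 * Re (w * W.[w])].
Proof.
move=> eta0; have [k [j [s2k J0 Jeta]]] : exists k j,
    [/\ Num.sqrt 2 ^+ k.+1 = 2 ^+ j :> R, 0 < 2 ^+ j :> R &
        (2 ^+ j)^-1 <= eta].
  (* [k.+1] is even, which makes the normalising constant the power [2 ^+ j]. *)
  pose j := (Num.trunc eta^-1).+1; exists j.*2.-1, j.
  have J0 : 0 < 2 ^+ j :> R by rewrite exprn_gt0.
  split=> //.
    rewrite (_ : j.*2.-1.+1 = j.*2); last by rewrite /j; lia.
    by rewrite -mul2n exprM sqr_sqrtr.
  rewrite invf_ple ?posrE// ltW// (lt_le_trans (truncnS_gt _))//.
  by rewrite -natrX ler_nat ltnW// ltn_expl.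
have /= := rudin_shapiro_spec k.+1; have := rudin_shapiro_spec k.
case: (rudin_shapiro k) => p q [[sp sq] c1 pq _] [_ c2 _ tk].
have [W0 W0E] := conj_polyE sp.
pose c : R[i] := ((2 ^+ j)^-1)%:C.
have nmc : nm c = (2 ^+ j)^-1 by rewrite nmR ger0_norm// invr_ge0 ltW.
exists (c *: (p + 'X^(2 ^ k) * q)), ((c ^+ 2) *: (W0 * q)).
split=> [w n w1|i|w w1].
- rewrite (linearZ_LR (take_poly n)) /= hornerZ nmM nmc.
  by rewrite ler_pdivrMl// [2 ^+ j * _]mulrC -s2k; have [] := tk w n w1.
- rewrite coefZ nmM nmc (le_trans _ Jeta)// ler_piMr ?invr_ge0 ?(ltW J0)//.
  by have [] := c2 i.
- rewrite !hornerZ nmM exprMn nmc hornerD !hornerM hornerXn.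
  have -> : w * (c ^+ 2 * (W0.[w] * q.[w])) = c ^+ 2 * ((w * W0.[w]) * q.[w]).
    by ring.
  rewrite -W0E//; have := pq w w1.
  have -> : 2 ^+ k.+1 = (2 ^+ j) ^+ 2 :> R.
    by rewrite -s2k -exprM mulnC exprM sqr_sqrtr.
  have : nm (w ^+ (2 ^ k)) = 1 by rewrite nmX w1 expr1n.
  have -> : c ^+ 2 = ((2 ^+ j)^-1 ^+ 2)%:C by rewrite /c rmorphXn.
  rewrite ReZ nm_sqrD.
  move: (w ^+ _) p.[w] q.[w] => u a b u1 ab.
  have -> : u * conjc a * b = conjc a * (u * b) by ring.
  have -> : nm (u * b) = nm b by rewrite nmM u1 mul1r.
  rewrite ab mulrDr exprVn mulVf ?expf_neq0 ?gt_eqF//; ring.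
Qed.

End RudinShapiro.

(** * Truncations of a product [q * (r \Po 'X^N)] *)

Section LacunaryBlocks.
Context {R : realType}.
Implicit Types (q r : {poly R[i]}) (w : R[i]).

(** The copies of [q] shifted by multiples of [N] do not overlap, so that a coefficient is found by
    Euclidean division. *)
Lemma coef_mul_comp_polyXn q r N i : (size q <= N)%N -> (0 < N)%N ->
  (q * (r \Po 'X^N))`_i = q`_(i %% N) * r`_(i %/ N).
Proof.
move=> qN N0; elim/poly_ind: r i => [|r c IH] i.
  by rewrite comp_poly0 mulr0 !coef0 mulr0.
rewrite comp_polyD comp_polyM comp_polyX comp_polyC mulrDr coefD mulrA.
rewrite coefMXn coefMC coefD coefMX coefC.
case: ltnP => iN; first by rewrite modn_small// divn_small// !add0r.
have [m ->] : exists m, i = (m + N)%N by exists (i - N)%N; rewrite subnK.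
rewrite addnK IH modnDr divnDr// divnn N0 addn1/= addr0.
by rewrite [q`_(m + N)]nth_default ?mul0r ?addr0// (leq_trans qN)// leq_addl.
Qed.

Lemma take_mul_comp_polyXn q r N n : (size q <= N)%N -> (0 < N)%N ->
  take_poly n (q * (r \Po 'X^N)) =
  q * (take_poly (n %/ N) r \Po 'X^N) +
  r`_(n %/ N) *: ('X^(N * (n %/ N)) * take_poly (n %% N) q).
Proof.
move=> qN N0; apply/polyP => i.
rewrite coef_take_poly coefD !coef_mul_comp_polyXn// coefZ coefXnM.
rewrite !coef_take_poly.
have := divn_eq i N; have := divn_eq n N.
have := ltn_pmod i N0; have := ltn_pmod n N0.
move: (i %/ N)%N (i %% N)%N (n %/ N)%N (n %% N)%N => k x l y yN xN -> ->.
have [kl|lk|->] := ltngtP k l.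
- have e1 : (k * N + x < l * N)%N.
    have : (k.+1 * N <= l * N)%N by rewrite leq_mul2r kl orbT.
    rewrite mulSn; lia.
  by rewrite (leq_trans e1) ?leq_addr// [(N * l)%N]mulnC e1 mulr0 addr0.
- have e1 : (l * N + y < k * N)%N.
    have : (l.+1 * N <= k * N)%N by rewrite leq_mul2r lk orbT.
    rewrite mulSn; lia.
  rewrite ifF; last by apply/negbTE; rewrite -leqNgt; lia.
  rewrite mulr0 add0r ifF; last by apply/negbTE; rewrite -leqNgt; lia.
  rewrite ifF ?mulr0//; apply/negbTE; rewrite -leqNgt.
  have : (l.+1 * N <= k * N)%N by rewrite leq_mul2r lk orbT.
  rewrite mulSn; lia.
- rewrite ltn_add2l mulr0 add0r [(N * l)%N]mulnC.
  rewrite [(_ < l * N)%N]ltnNge leq_addr /= addKn.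
  by case: ifP; rewrite ?mulr0// mulrC.
Qed.

Lemma nm_take_poly_le q n w : nm w = 1 ->
  nm (take_poly n q).[w] <= \sum_(i < size q) nm q`_i.
Proof.
move=> w1; have sz : (size (take_poly n q) <= size q)%N.
  apply/leq_sizeP => j qj; rewrite coef_take_poly.
  by case: ifP => // _; rewrite nth_default.
rewrite (horner_coef_wide _ sz) (le_trans (nm_sum _ _ _))// ler_sum// => i _.
rewrite nmM nmX w1 expr1n mulr1 coef_take_poly.
by case: ifP; rewrite // nm0 nm_ge0.
Qed.

(** The whole copies add up to a partial sum of [r] times [q], hence a bound proportional to the
    modulus of [q] at the same point. The single cut copy has only the crude bound by its
    coefficients, but the small weight [e]. *)
Lemma nm_take_block_le q r N n w (e : R) : (size q <= N)%N -> (0 < N)%N ->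
  (forall w n, nm w = 1 -> nm (take_poly n r).[w] <= 4) ->
  (forall i, nm r`_i <= e) -> nm w = 1 ->
  nm (take_poly n (q * (r \Po 'X^N))).[w] <=
    4 * nm q.[w] + e * \sum_(i < size q) nm q`_i.
Proof.
move=> qN N0 r4 re w1; rewrite take_mul_comp_polyXn// hornerD hornerZ !hornerM.
rewrite horner_comp !hornerXn (le_trans (nmD _ _))//.
have w1X k : nm (w ^+ k) = 1 by rewrite nmX w1 expr1n.
apply: lerD.
  by rewrite nmM mulrC ler_wpM2r ?nm_ge0// r4.
rewrite !nmM w1X mul1r; apply: ler_pM; rewrite ?nm_ge0//.
exact: nm_take_poly_le.
Qed.

End LacunaryBlocks.

(** * Upper bounds for the logarithm *)

Section LogEstimate.
Context {R : realType}.
Implicit Types (x : R).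

(** The difference [f] vanishes at 0 and its derivative [y ^+ 3 / (1 + y)] has the sign of [y]; the
    mean value theorem concludes. *)
Lemma ln1D_le3 x : -1 < x -> ln (1 + x) <= x - x ^+ 2 / 2 + x ^+ 3 / 3.
Proof.
move=> x1; pose f y : R := y - y ^+ 2 / 2 + y ^+ 3 / 3 - ln (1 + y).
have df (y : R) : -1 < y -> is_derive y 1 f (y ^+ 3 / (1 + y)).
  move=> y1; have y0 : 0 < 1 + y by lra.
  have dl : is_derive y 1 (fun y : R => ln (1 + y)) ((1 + y)^-1).
    have := is_derive1_ln y0 => dl.
    have ds : is_derive y 1 (cst 1 + id : R -> R) 1.
      by rewrite -[X in is_derive _ _ _ X]add0r; exact: is_deriveD.
    by have := @is_derive1_comp R (@ln R) (cst 1 + id) y _ _ dl ds;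
       rewrite mulr1.
  rewrite /f; apply: is_derive_eq; rewrite /GRing.scale/=.
  by field; lra.
have f0 : f 0 = 0 by rewrite /f addr0 ln1 !expr0n/= !mul0r; lra.
suff : 0 <= f x by rewrite /f; lra.
have [x0|x0|->] := ltgtP x 0; last by rewrite f0.
  have [] := @MVT R f (fun y => y ^+ 3 / (1 + y)) x 0 x0.
  - by move=> y; rewrite in_itv/= => /andP[xy _]; apply: df; lra.
  - apply: derivable_within_continuous => y; rewrite in_itv/= => /andP[xy _].
    by have [] : is_derive y 1 f (y ^+ 3 / (1 + y)) by apply: df; lra.
  move=> c; rewrite in_itv/= f0 => /andP[xc c0] fx.
  have c10 : 0 < (1 + c)^-1 by rewrite invr_gt0; lra.
  have : c ^+ 3 / (1 + c) <= 0 by rewrite pmulr_lle0//; nra.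
  nra.
have [] := @MVT R f (fun y => y ^+ 3 / (1 + y)) 0 x x0.
- by move=> y; rewrite in_itv/= => /andP[xy _]; apply: df; lra.
- apply: derivable_within_continuous => y; rewrite in_itv/= => /andP[xy _].
  by have [] : is_derive y 1 f (y ^+ 3 / (1 + y)) by apply: df; lra.
move=> c; rewrite in_itv/= f0 => /andP[xc c0] fx.
have c10 : 0 < (1 + c)^-1 by rewrite invr_gt0; lra.
have : 0 <= c ^+ 3 / (1 + c) by rewrite pmulr_rge0 ?exprn_gt0//; lra.
nra.
Qed.

(* For v without constant frequency v and v ^+ 2 have mean 0, so that the mean of
   ln |1 + v|^2 is bounded by a cubic error. *)
Lemma ln_nm1D_le (v : R[i]) : nm v <= 1 / 2 ->
  ln (nm (1 + v) ^+ 2) <= 2 * Re v - Re (v ^+ 2) + 8 * nm v ^+ 3.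
Proof.
move=> v2; have v0 := nm_ge0 v.
have := nm_Re v; rewrite ler_norml => /andP[s1 s2].
have vE := nm_sqr v.
have -> : nm (1 + v) ^+ 2 = 1 + (2 * Re v + nm v ^+ 2).
  by rewrite !nm_sqr ReD ImD /=; ring.
have -> : Re (v ^+ 2) = 2 * Re v ^+ 2 - nm v ^+ 2.
  by rewrite nm_sqr expr2 ReM; ring.
move: vE s1 s2 v0 v2; move: (nm v) (Re v) (Im v) => p s i pE s1 s2 p0 p2.
have x1 : -1 < 2 * s + p ^+ 2 by nra.
apply: le_trans (ln1D_le3 x1) _.
(* The cubic error is at most [(125 / 24 + 2) * p ^+ 3], which [8 * p ^+ 3] covers. *)
have xl : 2 * s + p ^+ 2 <= 5 / 2 * p by nra.
have x3 : (2 * s + p ^+ 2) ^+ 3 <= (5 / 2 * p) ^+ 3.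
  have [x0|x0] := lerP 0 (2 * s + p ^+ 2).
    by rewrite ler_pXn2r ?nnegrE//; nra.
  apply: (@le_trans _ _ 0); last by rewrite exprn_ge0//; nra.
  by rewrite exprSr nmulr_lle0// sqr_ge0.
have p3 : - 2 * s * p ^+ 2 <= 2 * p ^+ 3 by have := sqr_ge0 p; nra.
have p4 : 0 <= p ^+ 4 by rewrite exprn_ge0.
have p30 : 0 <= p ^+ 3 by rewrite exprn_ge0.
have e1 : (5 / 2 * p) ^+ 3 = 125 / 8 * p ^+ 3 by field.
have e2 : (2 * s + p ^+ 2) ^+ 2 = 4 * s ^+ 2 + 4 * s * p ^+ 2 + p ^+ 4 by ring.
rewrite e2; lra.
Qed.

End LogEstimate.

(** * One step of the multiplicative walk *)

Section Iteration.
Context {R : realType}.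
Variables (a b delta : R).
Hypotheses (a0 : 0 < a) (ab : a < b) (delta0 : 0 < delta) (delta8 : delta * 8 <= 1).
Variables (p : R -> R[i]) (N0 : nat) (eta : R).
Hypotheses (tp : trigpoly p) (eta0 : 0 < eta).
Implicit Types (G : R -> R[i]) (P : {poly R[i]}).

(* As a function of x = |G|^2 / b^2 the speed is a polynomial, so that it yields a
   trigonometric polynomial; it vanishes where |G| = a or |G| = b. *)
Definition speed (x : R) : R := delta * (x - (a / b) ^+ 2) * (1 - x).

Definition psi G t : R := speed (nm (G t) ^+ 2 / b ^+ 2).

(* In the last clause, 1 + b is the share of the completed blocks and 4 b that of the
   block that is cut. *)
Definition admissible G P :=
  [/\ trigpoly G, forall t, a <= nm (G t) <= b,
      forall t, P.[expi t] = p t * (1 - G t),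
      forall i, (i < N0)%N -> P`_i = 0 &
      forall n t, nm (take_poly n P).[expi t] <= (1 + 5 * b) * nm (p t) + eta].

(** In the unit [b] the speed is at most [delta] times twice the distance to either end, and
    [delta * 8 <= 1]. A relative step of size at most [4 * s] therefore cannot leave the interval; 4
    is the sup bound of the flat polynomial. *)
Lemma speed_bounds (g : R) : a <= g <= b -> let s := speed (g ^+ 2 / b ^+ 2) in
  [/\ 0 <= s <= delta, g * (1 + 4 * s) <= b & a <= g * (1 - 4 * s)].
Proof.
move=> /andP[ag gb]; have b0 : 0 < b by exact: lt_trans ab.
pose y := g / b; pose al := a / b.
have gE : g = y * b by rewrite /y divfK// gt_eqF.
have aE : a = al * b by rewrite /al divfK// gt_eqF.
have -> : g ^+ 2 / b ^+ 2 = y ^+ 2 by rewrite /y expr_div_n.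
rewrite /speed -/al /=.
have al0 : 0 < al by rewrite divr_gt0.
have aly : al <= y by rewrite ler_pM2r ?invr_gt0.
have y1 : y <= 1 by rewrite ler_pdivrMr// mul1r.
have u0 : 0 <= y ^+ 2 - al ^+ 2 by rewrite subr_sqr; nra.
have u1 : y ^+ 2 - al ^+ 2 <= 1 by have := sqr_ge0 al; nra.
have v0 : 0 <= 1 - y ^+ 2 by nra.
have v1 : 1 - y ^+ 2 <= 1 by have := sqr_ge0 y; lra.
have uv : 0 <= (y ^+ 2 - al ^+ 2) * (1 - y ^+ 2) by rewrite mulr_ge0.
have w1 : (y ^+ 2 - al ^+ 2) * (1 - y ^+ 2) <= 2 * (1 - y).
  apply: le_trans (_ : 1 * (1 - y ^+ 2) <= _); first exact: ler_wpM2r.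
  by rewrite mul1r; nra.
have w2 : (y ^+ 2 - al ^+ 2) * (1 - y ^+ 2) <= 2 * (y - al).
  apply: le_trans (_ : (y ^+ 2 - al ^+ 2) * 1 <= _); first exact: ler_wpM2l.
  by rewrite mulr1 subr_sqr; nra.
have w3 : (y ^+ 2 - al ^+ 2) * (1 - y ^+ 2) <= 1.
  by rewrite -[leRHS]mulr1; apply: ler_pM.
rewrite -mulrA; move: ((y ^+ 2 - al ^+ 2) * (1 - y ^+ 2)) uv w1 w2 w3 => w ? ? ? ?.
have d0 := delta0; have dw : 4 * (delta * w) <= w / 2.
  have : delta * 8 * w <= 1 * w by exact: ler_wpM2r.
  lra.
have dw0 : 0 <= delta * w by rewrite mulr_ge0// ltW.
split.
- by rewrite dw0 /=; nra.
- by rewrite gE -[leRHS]mul1r [leLHS]mulrAC ler_pM2r//; nra.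
- by rewrite gE [leLHS]aE [leRHS]mulrAC ler_pM2r//; nra.
Qed.

Lemma trigpoly_psi G : trigpoly G -> trigpoly (fun t => (psi G t)%:C).
Proof.
move=> tG.
have tN : trigpoly (fun t => (nm (G t) ^+ 2)%:C).
  apply: (trigpoly_eq (F := fun t => G t * conjc (G t))).
    by move=> t; rewrite nm_sqrC.
  by apply: trigpolyM => //; exact: trigpoly_conj.
have tX : trigpoly (fun t => (nm (G t) ^+ 2 / b ^+ 2)%:C).
  apply: (trigpoly_eq (F := fun t => (nm (G t) ^+ 2)%:C * (b ^+ 2)^-1%:C)).
    by move=> t; rewrite [RHS]rmorphM.
  by apply: trigpolyM => //; exact: trigpoly_cst.
apply: (trigpoly_eq (F := fun t => delta%:C *
  ((nm (G t) ^+ 2 / b ^+ 2)%:C - ((a / b) ^+ 2)%:C) *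
  (1%:C - (nm (G t) ^+ 2 / b ^+ 2)%:C))).
  by move=> t; rewrite /psi /speed -!rmorphB -!rmorphM.
by apply: trigpolyM; [apply: trigpolyM; [|apply: trigpolyB]|apply: trigpolyB];
   rewrite //; exact: trigpoly_cst.
Qed.

(** Up to the factor [pi *+ 2] these are means: of the second moment of the walk, of its increment
    in one step, and of a logarithm that is nearly conserved. *)
Definition energy G := intT (fun t => nm (G t) ^+ 2).
Definition gain G := intT (fun t => nm (G t) ^+ 2 * psi G t ^+ 2).
Definition logmass G := intT (fun t => ln (nm (G t) ^+ 2)).

Lemma continuous_fctX (u : R -> R) n : continuous u -> continuous (fun t => u t ^+ n).
Proof.
move=> cu; elim: n => [|n IH]; first by move=> t; exact: cvg_cst.
rewrite (_ : (fun t => _) = (fun t => u t * u t ^+ n)).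
  by move=> t; exact: (cvgM (cu t) (IH t)).
by apply/funext => t; rewrite exprS.
Qed.

Lemma continuous_fctD (g h : R -> R) : continuous g -> continuous h ->
  continuous (fun t => g t + h t).
Proof. by move=> cg ch t; exact: (cvgD (cg t) (ch t)). Qed.

Lemma continuous_fctZ (c : R) (h : R -> R) : continuous h -> continuous (fun t => c * h t).
Proof. by move=> ch t; apply: cvgM; [exact: cvg_cst|exact: ch]. Qed.

Lemma continuous_fctN (h : R -> R) : continuous h -> continuous (fun t => - h t).
Proof. by move=> ch t; exact: (cvgN (ch t)). Qed.

Lemma continuous_psi G : trigpoly G -> continuous (psi G).
Proof. by move=> /trigpoly_psi /ccont_trigpoly []. Qed.

Lemma continuous_nm2 G : trigpoly G -> continuous (fun t => nm (G t) ^+ 2).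
Proof. by move=> tG; apply: continuous_fctX; apply: ccont_nm; exact: ccont_trigpoly. Qed.

Lemma continuous_gain G :
  trigpoly G -> continuous (fun t => nm (G t) ^+ 2 * psi G t ^+ 2).
Proof.
move=> tG t; apply: cvgM; first exact: continuous_nm2.
exact: (continuous_fctX (continuous_psi tG)).
Qed.

Lemma continuous_ln_nm2 G : trigpoly G -> (forall t, a <= nm (G t)) ->
  continuous (fun t => ln (nm (G t) ^+ 2)).
Proof.
move=> tG aG t; apply: (@continuous_comp _ _ _ (fun t => nm (G t) ^+ 2) (@ln R)).
  exact: continuous_nm2.
by apply: continuous_ln; rewrite exprn_gt0// (lt_le_trans a0).
Qed.

(** [G] is multiplied by [1 + v], with [v] of high frequency, and [P] is corrected by [- p * G * v].
    The cross terms integrate to 0; in the logarithm the terms of order 1 and 2 do so as well, and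
    what is left is cubic in [v], hence at most a multiple of [delta] times the gain. *)
Lemma admissible_step G P : admissible G P -> exists G' P', [/\ admissible G' P',
  energy G' = energy G + gain G &
  logmass G' <= logmass G + 32 * delta / a ^+ 2 * gain G].
Proof.
move=> [tG Gab PE PN Pn].
pose Psi t := (psi G t)%:C.
have tPsi : trigpoly Psi by exact: trigpoly_psi.
have tG2 : trigpoly (fun t => G t * conjc (G t)).
  by apply: trigpolyM => //; exact: trigpoly_conj.
have [d [q qE]] : trigpoly (fun t => p t * G t * Psi t).
  by apply: trigpolyM => //; exact: trigpolyM.
have [d1 z1] := intT_trigpoly (trigpolyM tG2 tPsi).
have [d2 z2] := intT_trigpoly (trigpolyM (trigpolyM tG2 tPsi) tPsi).
have [d3 z3] := intT_trigpoly tPsi.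
have [d4 z4] := intT_trigpoly (trigpolyM tPsi tPsi).
pose S := \sum_(i < size q) nm q`_i.
have S0 : 0 <= S by apply: sumr_ge0 => i _; exact: nm_ge0.
(* With coefficients this small, a cut copy of [q] costs at most [eta]; [r] is chosen after [q]. *)
have e0 : 0 < eta / (1 + S) by rewrite divr_gt0// ltr_pwDl.
have [r [W [r4 re rW]]] := flat_poly e0.
pose m := maxn N0 (size P).
(* [N - d >= m] places the new block above [N0] and above the spectrum of [P], [N >= size q]
   separates the copies of [q], and the other terms make the means vanish. *)
pose N := (d + m + size q + d1 + d2 + d3 + d4).+1.
have N_gt0 : (0 < N)%N by [].
have qN : (size q <= N)%N by rewrite /N; lia.
have mN : (m <= N - d)%N by rewrite /N; lia.
have dN : (d <= N)%N by rewrite /N; lia.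
have [dN1 dN2] : (d1 <= N)%N /\ (d2 <= N)%N by rewrite /N; lia.
have [dN3 dN4] : (d3 <= N)%N /\ (d4 <= N)%N by rewrite /N; lia.
pose u t := expi t ^+ N * r.[expi t ^+ N].
pose v t := Psi t * u t.
pose w t := expi t ^+ N * W.[expi t ^+ N].
have tu : trigpoly u.
  apply: trigpoly_eq (trigpoly_horner ('X^N * (r \Po 'X^N))) => t.
  by rewrite hornerM horner_comp hornerXn.
have tw : trigpoly w.
  apply: trigpoly_eq (trigpoly_horner ('X^N * (W \Po 'X^N))) => t.
  by rewrite hornerM horner_comp hornerXn.
have tv : trigpoly v by exact: trigpolyM.
pose G' t := G t * (1 + v t).
have tG' : trigpoly G'.
  by apply: trigpolyM => //; apply: trigpolyD => //; exact: trigpoly_cst.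
pose B := q * (r \Po 'X^N).
(* The shift is [N - d] as [q] already contains [expi t ^+ d]; the block evaluates to
   [- (p t * G t * v t)]. *)
pose P' := P + 'X^(N - d) * (- B).
have psib t := speed_bounds (Gab t).
have u4 t : nm (u t) <= 4.
  have := r4 (expi t ^+ N) (size r) (nm_expiX t N).
  by rewrite take_poly_id// nmM nm_expiX mul1r.
have nv t : nm (v t) <= 4 * psi G t.
  rewrite nmM nmR ger0_norm; last by have [/andP[]] := psib t.
  by rewrite mulrC ler_wpM2r//; have [/andP[]] := psib t.
have u2 t : nm (u t) ^+ 2 = 1 + 2 * Re (w t).
  by rewrite nmM nm_expiX mul1r rW// nm_expiX.
have v2 t : nm (v t) ^+ 2 = psi G t ^+ 2 * (1 + 2 * Re (w t)).
  by rewrite -u2 nmM exprMn nmR real_normK ?num_real.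
have G'ab t : a <= nm (G' t) <= b.
  have [/andP[p0 _] h1 h2] := psib t; rewrite -/(psi G t) in p0 h1 h2.
  rewrite nmM; have G0 := nm_ge0 (G t); have := nv t => nvt; apply/andP; split.
    apply: le_trans h2 _; apply: ler_wpM2l => //.
    by have := ler_nmB 1 (- v t); rewrite opprK nmN nm1; lra.
  apply: le_trans _ h1; apply: ler_wpM2l => //.
  by have := nmD 1 (v t); rewrite nm1; lra.
exists G', P'; split.
- split => //.
  + move=> t; rewrite /P' hornerD hornerM hornerN hornerXn PE /B hornerM.
    rewrite horner_comp hornerXn -qE /G' /v /u.
    have -> : expi t ^+ N = expi t ^+ d * expi t ^+ (N - d).
      by rewrite -exprD subnKC.
    ring.
  + move=> i iN; rewrite coefD coefXnM PN// add0r ifT//.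
    by apply: leq_trans mN; apply: leq_trans iN _; rewrite leq_maxl.
  + move=> n t; rewrite take_poly_addXn; last first.
      by apply: leq_trans mN; rewrite leq_maxr.
    (* A cut inside [P] is covered by induction. A cut beyond it leaves [P] whole, equal to
       [p * (1 - G)], so that the errors [eta] of the steps do not add up. *)
    case: ifP => _; first exact: Pn.
    rewrite hornerD hornerM hornerXn (raddfN (take_poly _)) hornerN PE.
    apply: le_trans (nmD _ _) _; rewrite nmM nmM nm_expiX mul1r nmN.
    have [_ Gb] := andP (Gab t).
    have := nm_take_block_le (n - (N - d)) qN N_gt0 r4 re (nm_expi t).
    rewrite -/B -/S -qE !nmM nm_expiX mul1r => hB.
    have hS : eta / (1 + S) * S <= eta.
      rewrite mulrAC ler_pdivrMr; last by rewrite ltr_pwDl.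
      by rewrite ler_wpM2l ?(ltW eta0)// lerDr.
    have h1 : nm (1 - G t) <= 1 + b.
      by apply: le_trans (nmB _ _) _; rewrite nm1 lerD2l.
    have hP : nm (Psi t) <= 1.
      rewrite nmR; have [/andP[q0 q1] _ _] := psib t.
      by rewrite ger0_norm// (le_trans q1)//; have := delta8; have := delta0; lra.
    have p0 := nm_ge0 (p t).
    have h2 : nm (p t) * nm (1 - G t) <= nm (p t) * (1 + b) by exact: ler_wpM2l.
    have h3 : nm (p t) * nm (G t) * nm (Psi t) <= nm (p t) * b.
      rewrite -[leRHS]mulr1; apply: ler_pM; rewrite ?nm_ge0 ?mulr_ge0 ?nm_ge0//.
      exact: ler_wpM2l.
    move: hB h2 h3 hS; lra.
- rewrite /energy /gain.
  (* Only [nm (G t) ^+ 2] and the integrand of [gain] contribute; [z1] and [z2] remove the rest. *)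
  have -> : (fun t => nm (G' t) ^+ 2) = (fun t => (nm (G t) ^+ 2 +
      nm (G t) ^+ 2 * psi G t ^+ 2) + 2 * (Re (G t * conjc (G t) * Psi t * u t) +
      Re (G t * conjc (G t) * Psi t * Psi t * w t))).
    apply/funext => t; rewrite nmM exprMn nm_sqrD nm1 expr1n v2 conjc1 mul1r.
    have -> : Re (v t) = psi G t * Re (u t) by exact: ReZ.
    rewrite -nm_sqrC; have -> : (nm (G t) ^+ 2)%:C * Psi t * Psi t =
      (nm (G t) ^+ 2 * psi G t * psi G t)%:C by rewrite /Psi -!rmorphM.
    have -> : (nm (G t) ^+ 2)%:C * Psi t = (nm (G t) ^+ 2 * psi G t)%:C.
      by rewrite /Psi -rmorphM.
    by rewrite !ReZ; ring.
  have c1 : continuous (fun t => Re (G t * conjc (G t) * Psi t * u t)).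
    by apply: (ccont_trigpoly _).1; do !apply: trigpolyM => //.
  have c2 : continuous (fun t => Re (G t * conjc (G t) * Psi t * Psi t * w t)).
    by apply: (ccont_trigpoly _).1; do !apply: trigpolyM => //.
  have cG := continuous_nm2 tG; have cg := continuous_gain tG.
  rewrite intTD; last 2 first.
    by move=> t; exact: (cvgD (cG t) (cg t)).
    move=> t; apply: cvgM; first exact: cvg_cst.
    by exact: (cvgD (c1 t) (c2 t)).
  rewrite intTZ; last by move=> t; exact: (cvgD (c1 t) (c2 t)).
  rewrite [X in 2 * X]intTD// /u /w z1// z2// addr0 mulr0 addr0.
  by rewrite intTD.
- rewrite /logmass /gain.
  pose K := 32 * delta / a ^+ 2.
  have K0 : 0 <= 32 * delta by rewrite mulr_ge0// ltW.
  (* [8 * nm (v t) ^+ 3] is at most [32 * delta * psi G t ^+ 2 * (1 + 2 * Re (w t))]; the part with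
     [w] has mean 0 and gives the term with 64. *)
  pose F t := ln (nm (G t) ^+ 2) + K * (nm (G t) ^+ 2 * psi G t ^+ 2) +
    ((2 * Re (Psi t * u t) - Re (Psi t * Psi t * (u t * u t)))
     + 64 * delta * Re (Psi t * Psi t * w t)).
  have leF t : ln (nm (G' t) ^+ 2) <= F t.
    have [aG Gb] := andP (Gab t); have g0 : 0 < nm (G t) by exact: lt_le_trans aG.
    have [/andP[q0 q1] _ _] := psib t; rewrite -/(psi G t) in q0 q1.
    have d0 := delta0; have d8 := delta8.
    have nvt := nv t; have v12 : nm (v t) <= 1 / 2 by lra.
    have v1 : 0 < nm (1 + v t).
      by have := ler_nmB 1 (- v t); rewrite opprK nmN nm1; lra.
    rewrite nmM exprMn lnM ?posrE ?exprn_gt0//.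
    have := ln_nm1D_le v12.
    have : nm (v t) ^+ 3 <= 4 * delta * (psi G t ^+ 2 * (1 + 2 * Re (w t))).
      rewrite exprS -v2 ler_wpM2r ?sqr_ge0//; lra.
    (* [nm (G t) >= a] turns [psi G t ^+ 2] into the integrand of [gain]. *)
    have : psi G t ^+ 2 * (32 * delta) <= K * (nm (G t) ^+ 2 * psi G t ^+ 2).
      have : 1 <= nm (G t) ^+ 2 / a ^+ 2.
        by rewrite ler_pdivlMr ?exprn_gt0// mul1r ler_pXn2r// ?nnegrE ?nm_ge0// ltW.
      have := sqr_ge0 (psi G t).
      have -> : K * (nm (G t) ^+ 2 * psi G t ^+ 2) =
        (psi G t ^+ 2 * (32 * delta)) * (nm (G t) ^+ 2 / a ^+ 2).
        by rewrite /K; field; rewrite gt_eqF.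
      by move=> s0 ?; rewrite ler_peMr// mulr_ge0.
    have r1 : Re (Psi t * Psi t * w t) = psi G t ^+ 2 * Re (w t).
      by rewrite /Psi -rmorphM ReZ expr2.
    have r2 : Re (v t ^+ 2) = Re (Psi t * Psi t * (u t * u t)).
      by rewrite expr2 /v mulrACA.
    by rewrite /F r1 -r2 -/(v t); move: (ln _) (ln _) => l1 l2; lra.
  have cl := continuous_ln_nm2 tG (fun t => proj1 (andP (Gab t))).
  have cl' := continuous_ln_nm2 tG' (fun t => proj1 (andP (G'ab t))).
  have cg := continuous_gain tG.
  have c3 : continuous (fun t => Re (Psi t * u t)).
    by apply: (ccont_trigpoly _).1; do !apply: trigpolyM => //.
  have c4 : continuous (fun t => Re (Psi t * Psi t * (u t * u t))).
    by apply: (ccont_trigpoly _).1; do !apply: trigpolyM => //.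
  have c5 : continuous (fun t => Re (Psi t * Psi t * w t)).
    by apply: (ccont_trigpoly _).1; do !apply: trigpolyM => //.
  have cF : continuous F.
    apply: continuous_fctD; apply: continuous_fctD => //.
    - exact: continuous_fctZ.
    - by apply: continuous_fctD; [exact: continuous_fctZ|exact: continuous_fctN].
    - exact: continuous_fctZ.
  apply: le_trans (le_intT cl' cF leF) _.
  have -> : F = fun t => (ln (nm (G t) ^+ 2) + K * (nm (G t) ^+ 2 * psi G t ^+ 2)) +
    ((2 * Re (Psi t * u t) + (-1) * Re (Psi t * Psi t * (u t * u t)))
     + 64 * delta * Re (Psi t * Psi t * w t)).
    by apply/funext => t; rewrite mulN1r.
  have e3 : intT (fun t => Re (Psi t * u t)) = 0.
    by exact: z3.
  have e4 : intT (fun t => Re (Psi t * Psi t * (u t * u t))) = 0.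
    (* With [z = expi t ^+ N], [u t * u t] is [z * ('X * r * r).[z]]. *)
    rewrite -[RHS](z4 N ('X * r * r) dN4).
    congr intT; apply/funext => t; congr (Re (_ * _)).
    by rewrite /u !hornerM hornerX; ring.
  have e5 : intT (fun t => Re (Psi t * Psi t * w t)) = 0.
    by exact: z4.
  have C1 := continuous_fctZ (c := K) cg; have C3 := continuous_fctZ (c := 2) c3.
  have C4 := continuous_fctZ (c := -1) c4; have C5 := continuous_fctZ (c := 64 * delta) c5.
  have C34 := continuous_fctD C3 C4.
  rewrite (intTD (continuous_fctD cl C1) (continuous_fctD C34 C5)) (intTD cl C1).
  rewrite (intTD (continuous_fctD C3 C4) C5) (intTD C3 C4) (intTZ _ cg) (intTZ _ c3).
  by rewrite (intTZ _ c4) (intTZ _ c5) e3 e4 e5 !mulr0 !addr0.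
Qed.

End Iteration.

(** * Analytic polynomials close to [p] off a small set *)

Section KeyLemma.
Context {R : realType}.
Local Notation mu := (@lebesgue_measure R).
Local Notation T := [set` `[(0 : R)%R, (pi *+ 2)%R]].

(** Markov's inequality: [u] dominates the indicator of [A]. *)
Lemma le_mu_intT (u : R -> R) (A : set R) : continuous u ->
  (forall t, 0 <= u t) -> measurable A -> (forall t, A t -> 1 <= u t) ->
  (mu (T `&` A) <= (intT u)%:E)%E.
Proof.
move=> cu u0 mA uA.
have iu := integrableT cu.
rewrite /intT /Rintegral fineK; last exact: integrable_fin_num.
rewrite setIC -integral_indic//.
apply: ge0_le_integral => //.
- by apply/measurable_EFinP; exact: measurable_indic.
- by have /integrableP[] := iu.
- move=> t _; rewrite lee_fin indicE.
  by case: (boolP (t \in A)) => [/set_mem/uA|_].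
Qed.

Lemma measurable_gt (u : R -> R) (c : R) : continuous u ->
  measurable [set t | c < u t].
Proof.
move=> cu; apply: open_measurable; rewrite (_ : [set t | _] = u @^-1` `]c, +oo[).
  by apply: open_comp => // t _; exact: cu.
by apply/seteqP; split=> t /=; rewrite in_itv/= andbT.
Qed.

(** Applied to [x = g ^+ 2 / b ^+ 2] and [w = (a / b) ^+ 2] with [2 * a <= g <= b / 2]: in this
    middle range the speed stays away from 0. *)
Lemma speed_lower (x w : R) : 0 <= w -> 4 * w <= x -> x <= 1 / 4 ->
  3 * w * (3 / 4) <= (x - w) * (1 - x).
Proof. by move=> *; apply: ler_pM; lra. Qed.

(** Either [g <= b / 2] and the speed is bounded below, or [g > b / 2] and the logarithm lies at
    least [B] above its lowest value. The integral of this potential thus bounds the measure of the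
    set where the walk has not come near [a]. *)
Lemma one_le_potential (a b delta B g : R) : 0 < a -> 4 * a < b -> 0 < delta ->
  0 < B -> ln (b ^+ 2 / 4) = ln (a ^+ 2) + B -> 2 * a < g ->
  1 <= (4 * a ^+ 2 * (delta * (3 * (a / b) ^+ 2 * (3 / 4))) ^+ 2)^-1 *
         (g ^+ 2 * speed a b delta (g ^+ 2 / b ^+ 2) ^+ 2) +
       B^-1 * (ln (g ^+ 2) - ln (a ^+ 2)).
Proof.
move=> a0 ab d0 B0 lnb ag; have b0 : 0 < b by lra.
have g0 : 0 < g by lra.
have u1 : 0 <= g ^+ 2 * speed a b delta (g ^+ 2 / b ^+ 2) ^+ 2.
  by rewrite mulr_ge0 ?sqr_ge0.
have c00 : 0 < 4 * a ^+ 2 * (delta * (3 * (a / b) ^+ 2 * (3 / 4))) ^+ 2.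
  by rewrite !(divr_gt0, mulr_gt0, exprn_gt0).
have u2 : 0 <= ln (g ^+ 2) - ln (a ^+ 2).
  rewrite subr_ge0 ler_ln ?posrE ?exprn_gt0//.
  by rewrite ler_pXn2r// ?nnegrE; lra.
have [gb|gb] := lerP g (b / 2).
  apply: ler_wpDr; first by rewrite mulr_ge0 ?invr_ge0 ?(ltW B0).
  rewrite ler_pdivlMl// mulr1.
  have g2 : 4 * a ^+ 2 <= g ^+ 2.
    rewrite (_ : 4 * _ = (2 * a) ^+ 2); last by ring.
    by rewrite ler_pXn2r// ?nnegrE; lra.
  apply: ler_pM; [by rewrite mulr_ge0 ?sqr_ge0|exact: sqr_ge0|exact: g2|].
  have b20 : 0 < b ^+ 2 by rewrite exprn_gt0.
  have e1 : 4 * (a / b) ^+ 2 <= g ^+ 2 / b ^+ 2.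
    by rewrite expr_div_n mulrA ler_pM2r ?invr_gt0.
  have e2 : g ^+ 2 / b ^+ 2 <= 1 / 4.
    rewrite ler_pdivrMr// (_ : 1 / 4 * _ = (b / 2) ^+ 2); last by field.
    by rewrite ler_pXn2r// ?nnegrE; lra.
  have ab20 := sqr_ge0 (a / b).
  have e3 := speed_lower ab20 e1 e2.
  have w0 : 0 <= 3 * (a / b) ^+ 2 * (3 / 4) by move: ab20; clear; lra.
  rewrite /speed -[delta * _ * _]mulrA ler_pXn2r// ?nnegrE.
  - by apply: ler_wpM2l => //; exact: ltW.
  - by apply: mulr_ge0 => //; exact: ltW.
  - by apply: mulr_ge0; [exact: ltW|exact: le_trans e3].
apply: ler_wpDl; first by rewrite mulr_ge0 ?invr_ge0 ?(ltW c00).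
rewrite ler_pdivlMl// mulr1.
have : ln (b ^+ 2 / 4) <= ln (g ^+ 2).
  rewrite ler_ln ?posrE ?divr_gt0 ?exprn_gt0//.
  rewrite (_ : b ^+ 2 / 4 = (b / 2) ^+ 2); last by field.
  by rewrite ler_pXn2r// ?nnegrE; lra.
rewrite lnb; lra.
Qed.

(** A step with gain above [theta] raises the energy by more than [theta], and the energy never
    exceeds [b ^+ 2 * (pi *+ 2)]: a small gain must occur. The bounds on [logmass] telescope along
    the energy. *)
Lemma admissible_small_gain (a b delta : R) (p : R -> R[i]) (N0 : nat) (eta theta : R) :
  0 < a -> a < 1 -> 1 < b -> 0 < delta -> delta * 8 <= 1 -> trigpoly p ->
  0 < eta -> 0 < theta ->
  exists G P, [/\ admissible a b p N0 eta G P, gain a b delta G <= theta &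
    logmass G <= 32 * delta / a ^+ 2 * (b ^+ 2 * (pi *+ 2))].
Proof.
move=> a0 a1 b1 d0 d8 tp eta0 theta0; have ab := lt_trans a1 b1.
have b0 := lt_trans a0 ab.
pose kappa := 32 * delta / a ^+ 2.
have kappa0 : 0 <= kappa by rewrite divr_ge0 ?mulr_ge0 ?exprn_ge0// ltW.
have steps K : exists G P, [/\ admissible a b p N0 eta G P,
    logmass G <= kappa * (energy G - pi *+ 2) &
    gain a b delta G <= theta \/ pi *+ 2 + K%:R * theta <= energy G].
  elim: K => [|K [G [P [adm lm [small|large]]]]].
  - exists (fun=> 1), 0; split.
    + split.
      * exact: trigpoly_cst.
      * by move=> t; rewrite nm1 !ltW.
      * by move=> t; rewrite horner0 subrr mulr0.
      * by move=> i _; rewrite coef0.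
      * move=> n t; rewrite (raddf0 (take_poly n)) horner0 nm0.
        by rewrite addr_ge0 ?(ltW eta0)// mulr_ge0 ?nm_ge0//; lra.
    + rewrite /logmass /energy nm1 expr1n ln1 !intT_cst mul0r mul1r subrr.
      by rewrite mulr0.
    + by right; rewrite /energy nm1 expr1n intT_cst mul1r mul0r addr0.
  - by exists G, P; split=> //; left.
  - have [small|big] := lerP (gain a b delta G) theta.
      by exists G, P; split=> //; left.
    have [G' [P' [adm' eE lE]]] := admissible_step a0 ab d0 d8 tp eta0 adm.
    exists G', P'; split=> //.
      by apply: le_trans lE _; rewrite eE -/kappa; lra.
    by right; rewrite eE -natr1 mulrDl mul1r; lra.
(* After this many steps with large gain the energy would exceed its bound. *)
have [G [P [adm lm]]] := steps (Num.trunc (b ^+ 2 * (pi *+ 2) / theta)).+1.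
have [tG Gab _ _ _] := adm.
have le_energy : energy G <= b ^+ 2 * (pi *+ 2).
  rewrite -intT_cst; apply: le_intT.
  - exact: continuous_nm2.
  - by move=> t; exact: cvg_cst.
  - move=> t; have /andP[_ Gb] := Gab t.
    by rewrite ler_pXn2r// ?nnegrE ?nm_ge0// ltW.
have pi0 := @twopi_gt0 R.
case=> [small|large]; last first.
  have := truncnS_gt (b ^+ 2 * (pi *+ 2) / theta).
  by rewrite ltr_pdivrMr// => ?; exfalso; lra.
exists G, P; split=> //; apply: le_trans lm _.
by apply: ler_wpM2l => //; lra.
Qed.

(** [a], [b] and [delta], hence [C], are fixed from [M] and [eps] before [p] is given; the degree of
    [p] affects only the frequencies used. The three parts of the potential cost at most [eps / 4]
    each. *)
Lemma analytic_approximation (M eps : R) : 0 < M -> 0 < eps -> exists2 C : R, 0 <= C &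
  forall p, trigpoly p -> (forall t, nm (p t) <= M) ->
  forall N0 (eta : R), 0 < eta -> exists P : {poly R[i]},
  [/\ forall i, (i < N0)%N -> P`_i = 0,
      forall n t, nm (take_poly n P).[expi t] <= C * nm (p t) + eta &
      (mu (T `&` [set t | (eps < nm (p t - P.[expi t]))%R]) <= eps%:E)%E].
Proof.
move=> M0 eps0; have pi0 := @twopi_gt0 R.
pose y := eps / M; have y0 : 0 < y by rewrite divr_gt0.
(* Below both [1 / 2] and [y / 2], so that [2 * a * M <= eps]. *)
pose a := y / (2 * (1 + y)).
have a0 : 0 < a by rewrite divr_gt0// mulr_gt0// ltr_wpDl.
have aE : 2 * a * (1 + y) = y by rewrite /a; field; rewrite gt_eqF// ltr_wpDl.
have ay : 2 * a <= y by nra.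
have a12 : a < 1 / 2 by nra.
pose L := - ln (a ^+ 2).
have a20 : 0 < a ^+ 2 by rewrite exprn_gt0.
have L0 : 0 <= L by rewrite oppr_ge0 ln_le0//; nra.
(* The first two terms force [b > 1] and [b > 4 * a]; the last one makes the share of the constant
   [L] at most [eps / 4]. *)
pose B := 2 / a + 4 + 4 * (pi *+ 2 * L) / eps.
have a'0 : 0 < a^-1 by rewrite invr_gt0.
have B1 : 2 / a + 4 <= B.
  by rewrite lerDl divr_ge0 ?(ltW eps0)// mulr_ge0// mulr_ge0// ltW.
have B0 : 0 < B by lra.
(* Makes [B] the logarithmic distance from [a ^+ 2] to [(b / 2) ^+ 2]. *)
pose b := 2 * a * expR (B / 2).
have bB : ln (b ^+ 2) = ln (a ^+ 2) + ln 4 + B.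
  have -> : b ^+ 2 = a ^+ 2 * 4 * expR B.
    by rewrite [in RHS](splitr B) expRD /b; ring.
  have lnM' (x z : R) : 0 < x -> 0 < z -> ln (x * z) = ln x + ln z.
    by move=> x0 z0; rewrite lnM ?posrE.
  have a24 : 0 < a ^+ 2 * 4 by rewrite mulr_gt0.
  by rewrite (lnM' _ _ a24 (expR_gt0 B)) (lnM' _ _ a20 (ltr0Sn R 3)) expRK.
have b3 : 2 * a * (1 + B / 2) <= b.
  by apply: ler_wpM2l; [rewrite mulr_ge0// ltW|exact: expR_ge1Dx].
have aVa : a * a^-1 = 1 by rewrite divff// gt_eqF.
have aB : 2 * a * (1 + (2 / a + 4) / 2) <= 2 * a * (1 + B / 2).
  by apply: ler_wpM2l; [rewrite mulr_ge0// ltW|lra].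
have aB' : 2 * a * (1 + (2 / a + 4) / 2) = 2 + 6 * a.
  by field; rewrite gt_eqF.
have b1 : 1 < b by lra.
have b4a : 4 * a < b by lra.
have b0 : 0 < b by lra.
have BL : 4 * (pi *+ 2 * L) / eps <= B.
  by rewrite lerDr addr_ge0// mulr_ge0// ltW.
have LE : L = - ln (a ^+ 2) by [].
have lnb : ln (b ^+ 2 / 4) = ln (a ^+ 2) + B.
  by rewrite ln_div ?posrE ?exprn_gt0// bB; ring.
clearbody b; clearbody B; clearbody L; clearbody a.
(* [delta * Z <= 1] makes the share of [logmass] at most [eps / 4]. *)
pose Z := (32 * (pi *+ 2) * b ^+ 2 / a ^+ 2) / B * 4 / eps.
have Z0 : 0 <= Z.
  by rewrite ltW// !(divr_gt0, mulr_gt0, exprn_gt0).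
pose delta := (8 + Z)^-1.
have d0 : 0 < delta by rewrite invr_gt0; lra.
have dE : delta * (8 + Z) = 1 by rewrite /delta mulVf// gt_eqF//; lra.
have dZ : 0 <= delta * Z by rewrite mulr_ge0// ltW.
have d8 : delta * 8 <= 1 by lra.
have dZ1 : delta * Z <= 1 by lra.
clearbody delta.
pose c0 := 4 * a ^+ 2 * (delta * (3 * (a / b) ^+ 2 * (3 / 4))) ^+ 2.
have c00 : 0 < c0 by rewrite !(divr_gt0, mulr_gt0, exprn_gt0).
exists (1 + 5 * b); first by lra.
move=> p tp pM N0 eta eta0.
have theta0 : 0 < c0 * (eps / 4) by rewrite mulr_gt0 ?divr_gt0.
have [G [P [[tG Gab PE PN Pn] sm lm]]] :=
  admissible_small_gain N0 a0 (lt_trans a12 (ltac:(lra) : 1 / 2 < 1)) b1 d0 d8 tp eta0 theta0.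
exists P; split=> //.
(* Adding [L] makes the logarithm nonnegative, since [nm (G t) >= a]. *)
pose u t := c0^-1 * (nm (G t) ^+ 2 * psi a b delta G t ^+ 2) +
  B^-1 * (ln (nm (G t) ^+ 2) + L).
have cl : continuous (fun t => ln (nm (G t) ^+ 2)).
  by apply: (continuous_ln_nm2 a0) => // t; have /andP[] := Gab t.
have cg : continuous (fun t => nm (G t) ^+ 2 * psi a b delta G t ^+ 2).
  exact: continuous_gain.
have cL : continuous (fun _ : R => L) by move=> t; exact: cvg_cst.
have u1 t : 0 <= c0^-1 * (nm (G t) ^+ 2 * psi a b delta G t ^+ 2).
  by rewrite mulr_ge0 ?invr_ge0 ?(ltW c00)// mulr_ge0 ?sqr_ge0.
have u2 t : 0 <= B^-1 * (ln (nm (G t) ^+ 2) + L).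
  rewrite mulr_ge0 ?invr_ge0 ?(ltW B0)// LE subr_ge0 ler_ln ?posrE//; last first.
    by rewrite exprn_gt0// (lt_le_trans a0)//; have /andP[] := Gab t.
  by rewrite ler_pXn2r// ?nnegrE ?nm_ge0 ?(ltW a0)//; have /andP[] := Gab t.
have cu : continuous u.
  apply: (continuous_fctD (continuous_fctZ (c := c0^-1) cg)).
  exact: (continuous_fctZ (c := B^-1) (continuous_fctD cl cL)).
(* [p - P] equals [p * G], and [eps / M >= 2 * a]. *)
have sub : [set t | eps < nm (p t - P.[expi t])] `<=` [set t | 2 * a < nm (G t)].
  move=> t /=; rewrite PE (_ : p t - _ = p t * G t); last by ring.
  rewrite nmM => h; apply: le_lt_trans ay _; rewrite /y ltr_pdivrMr// mulrC.
  by apply: lt_le_trans h _; rewrite ler_wpM2r ?nm_ge0.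
have mG : measurable [set t | 2 * a < nm (G t)].
  by apply: measurable_gt; apply: ccont_nm; exact: ccont_trigpoly.
have mp : measurable [set t | eps < nm (p t - P.[expi t])].
  apply: measurable_gt; apply: ccont_nm; apply: ccontB; apply: ccont_trigpoly => //.
  exact: trigpoly_horner.
apply: (@le_trans _ _ (mu (T `&` [set t | 2 * a < nm (G t)]))).
  by apply: le_measure; rewrite ?inE; [exact: measurableI|exact: measurableI|
     exact: setIS].
apply: le_trans (@le_mu_intT u _ cu _ mG _) _.
- by move=> t; rewrite addr_ge0.
- move=> t /= Ga; have [aG Gb] := andP (Gab t).
  rewrite /u LE; exact: one_le_potential.
- rewrite lee_fin /u.
  have C1 := continuous_fctZ (c := c0^-1) cg.
  have C2 := continuous_fctZ (c := B^-1) (continuous_fctD cl cL).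
  rewrite (intTD C1 C2) (intTZ _ cg) (intTZ _ (continuous_fctD cl cL)) (intTD cl cL) intT_cst.
  have h1 : c0^-1 * gain a b delta G <= eps / 4 by rewrite ler_pdivrMl.
  have h2 : B^-1 * logmass G <= eps / 4.
    apply: (@le_trans _ _ (B^-1 * (32 * delta / a ^+ 2 * (b ^+ 2 * (pi *+ 2))))).
      by rewrite ler_wpM2l// invr_ge0 ltW.
    have -> : B^-1 * (32 * delta / a ^+ 2 * (b ^+ 2 * (pi *+ 2))) =
        eps / 4 * (delta * Z) by rewrite /Z; field; rewrite !gt_eqF.
    by rewrite -[leRHS]mulr1 ler_wpM2l// ?divr_ge0// ltW.
  have h3 : B^-1 * (L * (pi *+ 2)) <= eps / 4.
    rewrite ler_pdivrMl//.
    by move: BL; rewrite ler_pdivrMr// => h; lra.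
  by rewrite mulrDr -/(gain a b delta G) -/(logmass G); lra.
Qed.

End KeyLemma.

(** * Continuous functions on the circle *)

Section CircleFunctions.
Context {R : realType}.
Implicit Types (F : R -> R[i]).

Lemma circle_funZ (V : zmodType) (F : R -> V) (m : int) (t : R) :
  periodic F (pi *+ 2) -> F (t + (pi *+ 2) *~ m) = F t.
Proof.
move=> pF; case: m => n; first by rewrite -pmulrn; exact: periodicn.
rewrite NegzE mulrNz -pmulrn.
by have := periodicn pF n.+1 (t - (pi *+ 2) *+ n.+1); rewrite subrK => ->.
Qed.

Lemma mod_2pi (x : R) :
  exists y (m : int), x = y + (pi *+ 2) *~ m /\ - pi <= y <= pi.
Proof.
have pi0 := @twopi_gt0 R; pose m := Num.floor ((x + pi) / (pi *+ 2)).
exists (x - (pi *+ 2) *~ m), m; split; first by rewrite subrK.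
have /andP[] := floor_itv ((x + pi) / (pi *+ 2)).
rewrite -/m ler_pdivlMr// ltr_pdivrMr// -[_ *~ m in X in _ -> X]mulrzr.
rewrite intrD mulr1z; move: pi0; rewrite mulr2n; move: (m%:~R) => k *; apply/andP; split; lra.
Qed.

Lemma circle_bounded F : ccont F -> circle_fun F ->
  exists2 B, 0 < B & forall t, nm (F t) <= B.
Proof.
move=> cF pF; have pi0 := pi_ge0 R.
have [|c _ cmax] := @EVT_max R (fun t => nm (F t)) (- pi) pi _
    (continuous_subspaceT (ccont_nm cF)); first by lra.
exists (nm (F c) + 1) => [|t]; first by rewrite ltr_wpDl ?nm_ge0.
have [y [m [-> ypi]]] := mod_2pi t; rewrite (circle_funZ _ _ pF).
by apply: (le_trans (cmax y _)); rewrite ?in_itv//= lerDl.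
Qed.

Lemma ccontP F x (e : R) : ccont F -> 0 < e ->
  exists2 r, 0 < r & forall y, `|y - x| < r -> nm (F y - F x) < e.
Proof.
move=> [cr ci] e0; have e20 : 0 < e / 2 by rewrite divr_gt0.
have /cvgrPdist_lt/(_ _ e20)/nbhs_ballP[r1 /= r10 h1] := cr x.
have /cvgrPdist_lt/(_ _ e20)/nbhs_ballP[r2 /= r20 h2] := ci x.
exists (Num.min r1 r2) => [|y]; first by rewrite lt_min r10.
rewrite lt_min => /andP[yr1 yr2]; apply: le_lt_trans (nm_ReIm _) _.
have := h1 y; rewrite /ball/= distrC => /(_ yr1) {}h1.
have := h2 y; rewrite /ball/= distrC => /(_ yr2) {}h2.
rewrite ReD ReN ImD ImN [ltRHS]splitr; apply: ltrD; by rewrite distrC.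
Qed.

(** Only [t] is confined to a compact interval; [y] may leave it, as translates in [korovkin] do. *)
Lemma ccont_unif F (e : R) : ccont F -> 0 < e ->
  exists2 d, 0 < d & forall t y, - pi <= t <= pi -> `|y - t| < d ->
    nm (F y - F t) < e.
Proof.
move=> cF e0.
have FF : Filter (0 : R)^'+ by exact: at_right_proper_filter.
have cov := iffLR (compact_near_coveringP _) (@segment_compact R (- pi) pi).
have := cov R (0^'+) (fun d t => forall y, `|y - t| < d -> nm (F y - F t) < e) FF.
case=> [x _|d /= d0 hd].
  have e20 : 0 < e / 2 by rewrite divr_gt0.
  have [r r0 hr] := ccontP x cF e20.
  have r20 : 0 < r / 2 by rewrite divr_gt0.
  exists (ball x (r / 2), [set d | d < r / 2]) => /=.
    split; first exact: nbhsx_ballx.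
    exact: nbhs_right_lt.
  move=> [t d] /= [xt dr] y yt; rewrite /ball/= in xt.
  have h1 : nm (F t - F x) < e / 2 by apply: hr; rewrite distrC; lra.
  have h2 : nm (F y - F x) < e / 2.
    apply: hr; rewrite -(subrKA t) (le_lt_trans (ler_normD _ _))//.
    by rewrite [`|t - x|]distrC; lra.
  rewrite (_ : F y - F t = (F y - F x) - (F t - F x)); last by ring.
  by apply: le_lt_trans (nmB _ _) _; lra.
exists (d / 2) => [|t y tpi yt]; first by rewrite divr_gt0.
apply: (hd (d / 2)) => //=; last by rewrite divr_gt0.
by rewrite sub0r normrN gtr0_norm ?divr_gt0//; lra.
Qed.

(* With this, it suffices to test a positive kernel of mass 1 against 1 - cos. *)
Lemma korovkin F (e : R) : ccont F -> circle_fun F -> 0 < e ->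
  exists2 C, 0 <= C & forall s t, nm (F t - F s) <= e + C * (1 - cos (t - s)).
Proof.
move=> cF pF e0; have [B B0 FB] := circle_bounded cF pF.
have [d0 d00 hd] := ccont_unif cF e0.
have pi0 := pi_gt0 R.
pose d := Num.min d0 pi.
have d_gt0 : 0 < d by rewrite lt_min d00.
have d_le : d <= pi by rewrite ge_min lexx orbT.
have cd : 0 < 1 - cos d.
  by rewrite subr_gt0 -cos0 ltr_cos// in_itv/= ?lexx ?(ltW pi0)// ltW.
exists (2 * B / (1 - cos d)) => [|s t].
  by rewrite divr_ge0 ?(ltW cd)// mulr_ge0// ltW.
have c1 : 0 <= 1 - cos (t - s) by rewrite subr_ge0 cos_le1.
have [s' [m [-> spi]]] := mod_2pi s.
rewrite (circle_funZ _ _ pF).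
have [u [k [tE upi]]] := mod_2pi (t - s').
have -> : t = (s' + u) + (pi *+ 2) *~ k by rewrite -addrA -tE addrC subrK.
rewrite (circle_funZ _ _ pF).
have -> : cos (s' + u + pi *+ 2 *~ k - (s' + pi *+ 2 *~ m)) = cos u.
  rewrite -(circle_funZ (k - m) u (@cosD2pi R)) mulrzBr; congr cos; ring.
have [ud|ud] := ltP `|u| d.
  have : nm (F (s' + u) - F s') < e.
    by apply: hd => //; rewrite addrC addKr (lt_le_trans ud)// ge_min lexx.
  move/ltW/le_trans; apply; rewrite lerDl mulr_ge0 ?subr_ge0 ?cos_le1//.
  by rewrite divr_ge0 ?(ltW cd)// mulr_ge0// ltW.
(* Far from the diagonal the trivial bound [2 * B] is paid by [1 - cos u >= 1 - cos d]. *)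
have : cos u <= cos d.
  rewrite -(cos_norm u) leNgt ltr_cos -?leNgt// in_itv/= ?(ltW d_gt0)//.
  by rewrite normr_ge0 ler_norml.
move=> ucd; apply: (@le_trans _ _ (2 * B)).
  by apply: le_trans (nmB _ _) _; rewrite mulr_natl mulr2n lerD.
apply: (@le_trans _ _ (2 * B / (1 - cos d) * (1 - cos u))).
  rewrite mulrAC ler_pdivlMr// ler_wpM2l ?mulr_ge0// ?(ltW B0)//; lra.
by rewrite lerDr ltW.
Qed.

End CircleFunctions.

(** * Uniform approximation by discrete Fejer means *)

Section Fejer.
Context {R : realType}.
Implicit Types (F : R -> R[i]) (w z y : R[i]).

Lemma conjc_unit w : nm w = 1 -> w * conjc w = 1.
Proof. by move=> w1; rewrite -nm_sqrC w1 expr1n. Qed.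

(** Orthogonality of characters: off the diagonal this is a geometric sum whose ratio [x != 1]
    satisfies [x ^+ n = 1]. *)
Lemma sum_unity_powers y n k l : (k < n)%N -> (l < n)%N -> nm y = 1 ->
  y ^+ n = 1 -> (forall m, (0 < m < n)%N -> y ^+ m != 1) ->
  \sum_(j < n) (y ^+ j) ^+ k * conjc ((y ^+ j) ^+ l) = if k == l then n%:R else 0.
Proof.
move=> kn ln y1 yn yprim; pose x := y ^+ k * conjc (y ^+ l).
have xE (j : 'I_n) : (y ^+ j) ^+ k * conjc ((y ^+ j) ^+ l) = x ^+ j.
  by rewrite /x exprMn -!conjcX -!exprM !(mulnC j).
rewrite (eq_bigr _ (fun j _ => xE j)).
have yl1 : y ^+ l * conjc (y ^+ l) = 1 by rewrite conjc_unit// nmX y1 expr1n.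
case: eqVneq => [kl|kl].
  by rewrite /x kl yl1 (eq_bigr (fun=> 1)) ?sumr_const ?card_ord// => j _;
     rewrite expr1n.
have x1 : x != 1.
  apply/eqP => x1; have ykl : y ^+ k = y ^+ l.
    by rewrite -[LHS]mulr1 -yl1 mulrCA -/x x1 mulr1.
  have y0 : y != 0 by rewrite -nm_eq0 y1 oner_eq0.
  have aux a b : (a < b < n)%N -> y ^+ a = y ^+ b -> False.
    move=> /andP[ab bn] yab; have /eqP := yprim (b - a)%N (ltac:(lia)).
    apply; apply: (mulfI (expf_neq0 a y0)).
    by rewrite -exprD subnKC ?mulr1// ltnW.
  have [klt|lkt|/eqP] := ltngtP k l; last by rewrite (negbTE kl).
    by apply: (aux k l) => //; rewrite klt.
  by apply: (aux l k) => //; rewrite lkt.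
apply/eqP; rewrite -(mulrI_eq0 _ (mulfI (x := x - 1) _)) ?subr_eq0//.
rewrite -subrX1 /x exprMn -!conjcX -!exprM !(mulnC _ n) !exprM yn !expr1n.
by rewrite conjc1 mulr1 subrr.
Qed.

(** Once the square is expanded, the sum over the nodes keeps only the diagonal [k = l]. The kernels
    at [n] equidistant nodes thus add up to a constant, which replaces the integral of the Fejer
    kernel. *)
Lemma fejer_kernel_sum y z n : nm y = 1 -> nm z = 1 ->
  y ^+ n = 1 -> (forall m, (0 < m < n)%N -> y ^+ m != 1) ->
  \sum_(j < n) nm (\sum_(k < n) (z * y ^+ j) ^+ k) ^+ 2 = n%:R ^+ 2.
Proof.
move=> y1 z1 yn yprim; apply: (@complexI R).
rewrite rmorph_sum/= rmorphXn/= rmorph_nat.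
transitivity (\sum_(j < n) \sum_(k < n) \sum_(l < n)
    z ^+ k * conjc (z ^+ l) * ((y ^+ j) ^+ k * conjc ((y ^+ j) ^+ l))).
  apply: eq_bigr => j _; rewrite nm_sqrC (rmorph_sum (@conjc R)) mulr_suml.
  apply: eq_bigr => k _; rewrite mulr_sumr; apply: eq_bigr => l _ /=.
  by rewrite [_ ^+ k]exprMn [_ ^+ l]exprMn conjcM mulrACA.
rewrite exchange_big/=; transitivity (\sum_(k < n) (n%:R : R[i])); last first.
  by rewrite sumr_const card_ord -[LHS]mulr_natl expr2.
apply: eq_bigr => k _; rewrite exchange_big/= (bigD1 k)//= -mulr_sumr.
rewrite sum_unity_powers// eqxx conjc_unit ?nmX ?z1 ?expr1n// mul1r.
rewrite big1 ?addr0// => l lk; rewrite -mulr_sumr sum_unity_powers//.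
by rewrite ifF ?mulr0//; apply/negbTE; rewrite eq_sym.
Qed.

Lemma expi_primitive n : (0 < n)%N -> let y : R[i] := expi (pi *+ 2 / n%:R) in
  y ^+ n = 1 /\ forall m, (0 < m < n)%N -> y ^+ m != 1.
Proof.
move=> n0 y; have n0' : n%:R != 0 :> R by rewrite pnatr_eq0 -lt0n.
split.
  rewrite -expiMn mulrCA divff// mulr1 -[pi *+ 2]add0r expi_2pi.
  exact: expi0.
move=> m /andP[m0 mn]; rewrite -expiMn; apply/eqP => /(congr1 (@Re R))/=.
have -> : m%:R * (pi *+ 2 / n%:R) = (m%:R / n%:R * pi) *+ 2 :> R.
  by rewrite mulr2n [RHS]mulr2n; field.
rewrite cos_mulr2n cos2sin2.
have : 0 < sin (m%:R / n%:R * pi : R).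
  apply: sin_gt0_pi; rewrite mulr_gt0 ?divr_gt0 ?ltr0n ?pi_gt0//=.
  by rewrite gtr_pMl ?pi_gt0// ltr_pdivrMr ?ltr0n// mul1r ltr_nat.
by rewrite mulr2n; set s := sin _ => s0 h; have := exprn_gt0 2 s0; lra.
Qed.

(** Values of [F] at [n] nodes are averaged with weights [K j t], nonnegative of sum 1. By
    [korovkin] the error is at most [e / 2] plus [C] times the weighted sum of [1 - cos], which the
    formula for geometric sums bounds by [2 / n]. *)
Lemma fejer F (e : R) : ccont F -> circle_fun F -> 0 < e ->
  exists2 p, trigpoly p & forall t, nm (F t - p t) <= e.
Proof.
move=> cF pF e0; have e20 : 0 < e / 2 by rewrite divr_gt0.
have [C C0 FC] := korovkin cF pF e20.
pose n := (Num.trunc (4 * C / e)).+1.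
have n0 : (0 < n)%N by [].
have nR0 : 0 < n%:R :> R by rewrite ltr0n.
have nC : 2 * C / n%:R <= e / 2.
  rewrite ler_pdivrMr//; have := truncnS_gt (4 * C / e).
  by rewrite -/n ltr_pdivrMr// => h; lra.
pose x j : R := - (j%:R * (pi *+ 2 / n%:R)).
pose y : R[i] := expi (- (pi *+ 2 / n%:R)).
have yE j : y ^+ j = expi (x j) by rewrite -expiMn mulrN.
have nx j : expi (x j) = conjc (expi (pi *+ 2 / n%:R) ^+ j).
  by rewrite -expiMn /x; apply/eqP; rewrite eq_complex /= cosN sinN !eqxx.
have [rn rprim] := expi_primitive n0.
have yn : y ^+ n = 1 by rewrite yE nx rn conjc1.
have yprim m : (0 < m < n)%N -> y ^+ m != 1.
  move=> mn; rewrite yE nx -(inj_eq (inv_inj (@conjcK R))) conjcK conjc1.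
  exact: rprim.
pose D (t : R) := \sum_(k < n) expi t ^+ k.
pose K j t := nm (D (t + x j)) ^+ 2 / n%:R ^+ 2.
have K0 j t : 0 <= K j t by rewrite divr_ge0 ?sqr_ge0.
have K1 t : \sum_(j < n) K j t = 1.
  rewrite /K -mulr_suml; rewrite (eq_bigr (fun j : 'I_n =>
    nm (\sum_(k < n) (expi t * y ^+ j) ^+ k) ^+ 2)); last first.
    by move=> j _; rewrite /D expiD yE.
  by rewrite fejer_kernel_sum ?nm_expi// divff// expf_neq0// gt_eqF.
have Kc j t : K j t * (1 - cos (t + x j)) <= 2 / n%:R ^+ 2.
  rewrite /K mulrAC ler_pM2r ?invr_gt0 ?exprn_gt0//.
  set w := expi (t + x j).
  have -> : 1 - cos (t + x j) = nm (w - 1) ^+ 2 / 2.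
    have h := nm_expi (t + x j); have := nm_sqr w; rewrite h expr1n => h1.
    have -> : cos (t + x j) = Re w by [].
    move: h1; rewrite nm_sqr ReD ImD ReN ImN.
    by move: (Re w) (Im w) => a b /= h1; lra.
  rewrite mulrA -exprMn -nmM mulrC [D _ * _]mulrC -subrX1.
  have : nm (w ^+ n - 1) <= 2.
    by apply: le_trans (nmB _ _) _; rewrite nmX nm_expi expr1n nm1; lra.
  by have := nm_ge0 (w ^+ n - 1); nra.
exists (fun t => \sum_(j < n) F (- x j) * (K j t)%:C).
  apply: trigpoly_sum => j; apply: trigpolyM; first exact: trigpoly_cst.
  have tD : trigpoly (fun t => D (t + x j)).
    apply: trigpoly_sum => k.
    apply: (trigpoly_eq (F := fun t => (expi (x j) ^+ k) * ('X^k).[expi t])).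
      by move=> t; rewrite hornerXn expiD mulrC exprMn.
    apply: trigpolyM; [exact: trigpoly_cst|exact: trigpoly_horner].
  apply: (trigpoly_eq (F := fun t =>
    (D (t + x j) * conjc (D (t + x j))) * ((n%:R ^+ 2)^-1)%:C)).
    by move=> t; rewrite -nm_sqrC -rmorphM.
  apply: trigpolyM; last exact: trigpoly_cst.
  by apply: trigpolyM => //; exact: trigpoly_conj.
move=> t; have -> : F t = \sum_(j < n) F t * (K j t)%:C.
  by rewrite -mulr_sumr -(rmorph_sum (real_complex R)) K1 mulr1.
rewrite -sumrB (le_trans (nm_sum _ _ _))//.
apply: (@le_trans _ _ (\sum_(j < n) (e / 2 * K j t + C * (2 / n%:R ^+ 2)))).
  apply: ler_sum => j _; rewrite -mulrBl nmM nmR ger0_norm//.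
  apply: (@le_trans _ _ ((e / 2 + C * (1 - cos (t - - x j))) * K j t)).
    by rewrite ler_wpM2r.
  by rewrite mulrDl lerD2l -mulrA ler_wpM2l// mulrC opprK.
rewrite big_split/= -mulr_sumr K1 mulr1 sumr_const card_ord -[_ *+ n]mulr_natl.
have -> : n%:R * (C * (2 / n%:R ^+ 2)) = 2 * C / n%:R by field; rewrite gt_eqF.
lra.
Qed.

End Fejer.

(** * Reduction of the residual by one polynomial *)

Section StepLemma.
Context {R : realType}.
Local Notation mu := (@lebesgue_measure R).
Local Notation T := [set` `[(0 : R)%R, (pi *+ 2)%R]].
Implicit Types (F h : R -> R[i]).

(** The retraction onto the disc of radius [e], written without a case distinction so that
    continuity is immediate. *)
Definition cut (e : R) (w : R[i]) : R[i] := w * ((Num.max 1 (nm w / e))^-1)%:C.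

Lemma nm_cut e w : 0 < e -> nm (cut e w) <= e.
Proof.
move=> e0; have m1 : 1 <= Num.max 1 (nm w / e) by rewrite le_max lexx.
have m0 : 0 < Num.max 1 (nm w / e) by exact: lt_le_trans m1.
rewrite nmM nmR ger0_norm ?invr_ge0 ?(ltW m0)// ler_pdivrMr// mulrC.
by rewrite -ler_pdivrMr// le_max lexx orbT.
Qed.

Lemma cut_id e w : 0 < e -> nm w <= e -> cut e w = w.
Proof.
move=> e0 we; rewrite /cut max_l ?ler_pdivrMr ?mul1r//.
by rewrite invr1 mulr1.
Qed.

Lemma ccont_cut e F : 0 < e -> ccont F -> ccont (fun t => cut e (F t)).
Proof.
move=> e0 cF; apply: ccontM => //; apply: ccont_real => t.
apply: cvgV; first by rewrite gt_eqF// lt_max ltr01.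
apply: (@continuous_max R R (fun=> 1) (fun t => nm (F t) / e)).
  exact: cvg_cst.
by apply: cvgM; [exact: ccont_nm|exact: cvg_cst].
Qed.

(** [F] is approximated by a trigonometric polynomial [p], and [p] by [P]. Into [h] go [F - p] and
    [cut (e / 2) (p - P)]; nothing remains where [p - P] has modulus at most [e / 2]. Where [F]
    vanishes [p] is at most [eta], so the partial sums are small. *)
Lemma residual_step F (e : R) (N0 : nat) : ccont F -> circle_fun F -> 0 < e ->
  exists (P : {poly R[i]}) h, [/\ forall i, (i < N0)%N -> P`_i = 0,
    [/\ ccont h, circle_fun h & forall t, nm (h t) <= e],
    (mu (T `&` [set t | (F t - P.[expi t] - h t)%R != 0%R]) <= e%:E)%E &
    forall n t, F t = 0 -> nm (take_poly n P).[expi t] <= e].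
Proof.
move=> cF pF e0; have e20 : 0 < e / 2 by rewrite divr_gt0.
have [B B0 FB] := circle_bounded cF pF.
(* [C] is obtained from a bound on [p] before [p] is known, as the precision [eta] depends on
   [C]. *)
have [C C0 keyC] := analytic_approximation (addr_gt0 B0 e20) e20.
pose eta := e / 2 / (1 + C).
have C1 : 0 < 1 + C by rewrite ltr_pwDl.
have eta0 : 0 < eta by rewrite divr_gt0.
have etaE : eta + C * eta = e / 2.
  by rewrite -[X in X + _]mul1r -mulrDl mulrC divfK// gt_eqF.
have Ceta : 0 <= C * eta by rewrite mulr_ge0// ltW.
have [p tp Fp] := fejer cF pF eta0.
have pB t : nm (p t) <= B + e / 2.
  rewrite -(subrK (F t) (p t)) addrC; apply: le_trans (nmD _ _) _.
  by apply: lerD => //; rewrite nm_sym (le_trans (Fp t))//; lra.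
have [P [PN Pn Pmu]] := keyC p tp pB N0 (e / 2) e20.
pose g t := p t - P.[expi t].
have tg : trigpoly g by apply: trigpolyB => //; exact: trigpoly_horner.
have cp := ccont_trigpoly tp; have cg := ccont_trigpoly tg.
pose h t := (F t - p t) + cut (e / 2) (g t).
have ch : ccont h by apply: ccontD; [exact: ccontB|exact: ccont_cut].
exists P, h; split=> //.
- split=> // t.
    by rewrite /h pF (trigpoly_periodic tp) (trigpoly_periodic tg).
  apply: le_trans (nmD _ _) _; have := nm_cut (g t) e20; have := Fp t; lra.
- apply: (le_trans _ (le_trans Pmu _)); last by rewrite lee_fin; lra.
  have mT : measurable T by exact: measurable_itv.
  apply: le_measure; rewrite ?inE.
  + apply: measurableI => //.
    rewrite (_ : [set t | _] = [set t | 0 < nm (F t - P.[expi t] - h t)]).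
      apply: measurable_gt; apply: ccont_nm; apply: ccontB => //.
      by apply: ccontB => //; apply: ccont_trigpoly; exact: trigpoly_horner.
    by apply/seteqP; split=> t /=; rewrite lt0r nm_ge0 andbT nm_eq0.
  + by apply: measurableI => //; apply: measurable_gt; exact: ccont_nm.
  + move=> t [Tt /= ne]; split=> //=; rewrite ltNge; apply: contra ne => le_g.
    by rewrite /h (cut_id e20 le_g) /g; apply/eqP; ring.
- move=> n t Ft; apply: le_trans (Pn n t) _.
  have pt : nm (p t) <= eta by have := Fp t; rewrite Ft sub0r nmN.
  have := ler_wpM2l C0 pt; lra.
Qed.

End StepLemma.

(** * Comparison with the topology of [R[i]] *)

Section ComplexTopology.
Context {R : realType}.

Lemma complex_gt0 (e : R[i]) : 0 < e -> exists2 r, 0 < r & e = r%:C.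
Proof.
by case: e => a b; rewrite ltcE /= => /andP[/eqP -> a0]; exists a.
Qed.

Lemma open_Re_gt (x : R) : open [set z : R[i] | x < Re z].
Proof.
rewrite openE => z /= xz; rewrite /interior; apply/nbhs_ballP.
exists (Re z - x)%:C => /=; first by rewrite ltcR subr_gt0.
move=> w; rewrite -ball_normE /ball_ /= ltcR => zw.
have := le_lt_trans (nm_Re (z - w)) zw; rewrite ReD ReN ltr_norml; lra.
Qed.

Lemma open_Im_gt (x : R) : open [set z : R[i] | x < Im z].
Proof.
rewrite openE => z /= xz; rewrite /interior; apply/nbhs_ballP.
exists (Im z - x)%:C => /=; first by rewrite ltcR subr_gt0.
move=> w; rewrite -ball_normE /ball_ /= ltcR => zw.
have := le_lt_trans (nm_Im (z - w)) zw; rewrite ImD ImN ltr_norml; lra.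
Qed.

Lemma ccont_continuous (h : R -> R[i]) : ccont h -> continuous h.
Proof.
move=> ch t; apply/cvgrPdist_lt => e /complex_gt0[r r0 ->].
have [d d0 hd] := ccontP t ch r0.
apply/nbhs_ballP; exists d => //= s; rewrite /ball/= distrC => /hd.
by rewrite nm_sym -ltcR.
Qed.

Lemma nm_cvg (u : nat -> R[i]) (l : R[i]) :
  (forall e : R, 0 < e -> exists N, forall n, (N <= n)%N -> nm (u n - l) < e) ->
  u @ \oo --> l.
Proof.
move=> h; apply/cvgrPdist_lt => e /complex_gt0[r r0 ->].
have [N hN] := h r r0; exists N => // n /= /hN.
by rewrite nm_sym -ltcR.
Qed.

End ComplexTopology.

(** * Lusin's theorem on the circle *)

Section Lusin.
Context {R : realType}.
Local Notation mu := (@lebesgue_measure R).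
Local Notation D := [set` `](0 : R)%R, (pi *+ 2)%R[].

(** For each rational level the superlevel set is Borel up to a null set. Countably many null sets
    fit into one Borel null set [Z], on which the function is replaced by 0. *)
Lemma borel_version (u : R -> R) :
  (forall x, completed_algebra_gen mu [set t | x < u t]) ->
  exists v Z, [/\ measurable_fun setT (v : R -> R), measurable Z, mu Z = 0%E &
    forall t, ~ Z t -> u t = v t].
Proof.
move=> mu_u; have qP (q : rat) : exists A N, [/\ measurable A, mu.-negligible N &
    A `|` N = [set t | (ratr q : R) < u t]].
  by have [A mA [N nN AN]] := mu_u (ratr q : R); exists A, N.
have [A AP] := choice qP; have [N NP] := choice AP.
have : mu.-negligible (\bigcup_n
    (if unpickle n is Some q then N q else set0)).
  apply: negligible_bigcup => n; case: unpickle => [q|].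
    by have [] := NP q.
  exact: negligible_set0.
move=> [Z [mZ Z0 NZ]]; have {}NZ q : N q `<=` Z.
  by move=> t Nt; apply: NZ; exists (pickle q); [by []|rewrite pickleK].
pose v t := if t \in Z then 0 else u t.
exists v, Z; split=> //; last by move=> t Zt; rewrite /v memNset.
have mq (q : rat) : measurable [set t | (ratr q : R) < v t].
  have [mA _ AN] := NP q.
  rewrite (_ : [set t | _] =
    (A q `\` Z) `|` (if (ratr q : R) < 0 then Z else set0)).
    by apply: measurableU; [exact: measurableD|case: ifP].
  apply/seteqP; split=> t /=; rewrite /v.
    have [/set_mem Zt q0|/negP tZ qu] := boolP (t \in Z).
      by right; rewrite q0.
    have nZ : ~ Z t by move=> Zt; apply: tZ; exact: mem_set.
    left; split=> //; have : (A q `|` N q) t by rewrite AN.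
    by case=> // /NZ.
  case=> [[At nZ]|]; last by case: ifP => // q0 Zt; rewrite mem_set.
  rewrite memNset//; have : (A q `|` N q) t by left.
  by rewrite AN.
apply: (measurability _ (RGenOInfty.measurableE R)) => _ [_ [x ->] <-].
rewrite setTI (_ : _ @^-1` _ = \bigcup_(q : rat)
    (if x < ratr q then [set t | (ratr q : R) < v t] else set0)).
  apply: bigcupT_measurable_rat => q.
  by case: ifP => _; [exact: mq|exact: measurable0].
apply/seteqP; split=> t /=; rewrite in_itv/= andbT.
  move=> /rat_in_itvoo[q]; rewrite in_itv/= => /andP[xq qv].
  by exists q => //; rewrite xq.
by move=> [q _]; case: ifP => // xq /= qv; exact: lt_trans qv.
Qed.

(* Recovers t from an expression that is continuous and periodic away from 2 pi Z,
   which turns functions on a compact subset of ]0, 2 pi[ into functions on the circle. *)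
Lemma cot_half (t : R) : 0 < t < pi *+ 2 ->
  pi - 2 * atan (sin t / (1 - cos t)) = t.
Proof.
move=> /andP[t0 t2]; pose x := t / 2.
have xt : t = x *+ 2 by rewrite /x mulr2n -splitr.
have x0 : 0 < sin x.
  by apply: sin_gt0_pi; move: t2; rewrite xt mulr2n mulr2n /x => t2; lra.
have -> : sin t / (1 - cos t) = tan (pi / 2 - x).
  rewrite /tan sinB cosB sin_pihalf cos_pihalf !mul1r !mul0r subr0 add0r.
  rewrite xt sin_mulr2n cos_mulr2n cos2sin2 !mulr2n; field.
  by rewrite gt_eqF//=; have := exprn_gt0 2 x0; rewrite expr2 => *; rewrite gt_eqF//; lra.
rewrite tanK; first by rewrite [RHS]xt mulr2n; field.
by rewrite in_itv/=; move: t2; rewrite mulr2n /x => t2; apply/andP; split; lra.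
Qed.

(** [u] is continuous on a compact subset [K] of the open period, of almost full measure; its Tietze
    extension [g] is composed with a periodic map that is the identity on [K], by [cot_half]. *)
Lemma lusin_circle (u : R -> R) (e : R) : measurable_fun setT u -> 0 < e ->
  exists (c : R -> R) A, [/\ continuous c, periodic c (pi *+ 2),
    measurable A, (mu A <= e%:E)%E & forall t, D t -> ~ A t -> u t = c t].
Proof.
move=> mu_u e0.
have mD : measurable (D : set R) by exact: measurable_itv.
have finD : (mu D < +oo)%E.
  by rewrite lebesgue_measure_itv/= lte_fin twopi_gt0 sube0 ltry.
have [K [cK KD muK cuK]] :=
  measurable_almost_continuous mD finD e0 (measurable_funTS mu_u).
have clK : closed K by apply: compact_closed => //; exact: Rhausdorff.
have [M M0 uM] : exists2 M, 0 < M & forall t, K t -> `|u t| <= M.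
  have /compact_bounded[M [_ hM]] := continuous_compact cuK cK.
  exists (`|M| + 1) => [|t Kt]; first by rewrite ltr_wpDl.
  apply: hM; last by exists t.
  by rewrite (le_lt_trans (ler_norm M))// ltrDl.
have [g [ug cg _]] :=
  continuous_bounded_extension (pseudometric_normal (X := R)) clK M0 cuK uM.
(* [1 - cos] has a positive minimum on [K], which avoids the multiples of [pi *+ 2]; [k] keeps the
   denominator in [c] away from 0. *)
have [k k0 Kk] : exists2 k, 0 < k & forall t, K t -> k <= 1 - cos t.
  have [K0|/set0P Kne] := eqVneq K set0.
    by exists 1 => // t; rewrite K0.
  have cc : continuous (fun t : R => 1 - cos t).
    by move=> t; apply: cvgB; [exact: cvg_cst|exact: continuous_cos].
  have [c cinK cmin] := compact_EVT_min Kne cK (continuous_subspaceT cc).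
  exists (1 - cos c) => [|t Kt]; last by apply: cmin; exact: mem_set.
  have := KD _ (set_mem cinK); rewrite /= in_itv/= => cD.
  have [c1|] := ltP (cos c) 1; first by rewrite subr_gt0.
  move=> c1; have cc1 : cos c = 1 by apply/eqP; rewrite eq_le cos_le1.
  have sc0 : sin c = 0 by have := sin2cos2 c; rewrite cc1 expr1n subrr => /eqP;
    rewrite sqrf_eq0 => /eqP.
  (* [cos c = 1] would give [c = pi] by [cot_half], but the cosine of [pi] is -1. *)
  have := cot_half cD; rewrite sc0 mul0r atan0 mulr0 subr0 => pic.
  by have := cospi R; rewrite pic cc1; lra.
pose c t := g (pi - 2 * atan (sin t / Num.max (1 - cos t) k)).
exists c, (D `\` K); split.
- move=> t; apply: (@continuous_comp _ _ _
    (fun t : R => pi - 2 * atan (sin t / Num.max (1 - cos t) k)) g);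
    last exact: cg.
  apply: cvgB; first exact: cvg_cst.
  apply: cvgM; first exact: cvg_cst.
  apply: (@continuous_comp _ _ _ (fun t : R => sin t / Num.max (1 - cos t) k)
    (@atan R)); last exact: continuous_atan.
  apply: cvgM; first exact: continuous_sin.
  apply: cvgV; first by rewrite gt_eqF// lt_max k0 orbT.
  apply: (@continuous_max R R (fun t => 1 - cos t) (fun=> k)).
    by apply: cvgB; [exact: cvg_cst|exact: continuous_cos].
  exact: cvg_cst.
- by move=> t; rewrite /c (sinD2pi t) (cosD2pi t).
- by apply: measurableD => //; exact: closed_measurable.
- exact: ltW.
- move=> t Dt nDK; have Kt : K t by apply: contrapT => nK; apply: nDK.
  rewrite (ug _ (mem_set Kt)) /c max_l ?Kk// cot_half//.
Qed.

Lemma lusin_L0 (f : R -> R[i]) (e : R) : L0 f -> 0 < e ->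
  exists (c : R -> R[i]) A, [/\ ccont c, circle_fun c,
    measurable A, (mu A <= e%:E)%E & forall t, D t -> ~ A t -> f t = c t].
Proof.
move=> [_ mf] e0; have e20 : 0 < e / 2 by rewrite divr_gt0.
(* The sigma-algebra of [lebesgueType] consists of the unions of a Borel set and a negligible
   one. *)
have lev (U : set R[i]) : open U -> completed_algebra_gen mu (f @^-1` U).
  move=> oU; have := mf measurableT U (@sub_sigma_algebra _ setT (@open R[i]) U oU).
  by move=> h; move: h; rewrite setTI g_sigma_completed_algebra_genE.
have [a [Z1 [ma mZ1 Z10 fa]]] :=
  borel_version (u := fun t => Re (f t)) (fun x => lev _ (@open_Re_gt R x)).
have [b [Z2 [mb mZ2 Z20 fb]]] :=
  borel_version (u := fun t => Im (f t)) (fun x => lev _ (@open_Im_gt R x)).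
have [c1 [A1 [cc1 p1 mA1 muA1 ac]]] := lusin_circle ma e20.
have [c2 [A2 [cc2 p2 mA2 muA2 bc]]] := lusin_circle mb e20.
exists (fun t => Complex (c1 t) (c2 t)), ((A1 `|` Z1) `|` (A2 `|` Z2)).
have mU1 : measurable (A1 `|` Z1) by exact: measurableU.
have mU2 : measurable (A2 `|` Z2) by exact: measurableU.
split=> //.
- by move=> t; rewrite p1 p2.
- exact: measurableU.
- have sub (A Z : set R) : measurable A -> measurable Z -> mu Z = 0%E ->
      (mu A <= (e / 2)%:E)%E -> (mu (A `|` Z) <= (e / 2)%:E)%E.
    move=> mA mZ Z0 muA; apply: (@le_trans _ _ (mu A + mu Z)%E).
      exact: measureU2.
    by rewrite Z0 adde0.
  apply: (@le_trans _ _ (mu (A1 `|` Z1) + mu (A2 `|` Z2))%E).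
    exact: measureU2.
  by rewrite [e in e%:E]splitr EFinD; apply: leeD; exact: sub.
- move=> t Dt nA; apply/eqP; rewrite eq_complex /=.
  have nA1 : ~ A1 t by move=> ?; apply: nA; left; left.
  have nZ1 : ~ Z1 t by move=> ?; apply: nA; left; right.
  have nA2 : ~ A2 t by move=> ?; apply: nA; right; left.
  have nZ2 : ~ Z2 t by move=> ?; apply: nA; right; right.
  by rewrite fa// fb// ac// bc// !eqxx.
Qed.

End Lusin.

(** * Translation invariance and almost everywhere statements on the circle *)

Section Translation.
Context {R : realType}.
Local Notation mu := (@lebesgue_measure R).

(** The translated measure agrees with Lebesgue measure on half-open intervals, which determine
    it. *)
Lemma lebesgue_measure_shift (A : set R) (c : R) : measurable A ->
  pushforward mu ((fun t => t + c) : _ -> measurableTypeR R) A = mu A.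
Proof.
move=> mA; apply/esym/lebesgue_measure_unique => //=.
  exact: (@measurable_funD _ _ R setT id (cst c)).
move=> _ _ [[a b]] _ <-.
rewrite /pushforward (_ : _ @^-1` _ = `]a - c, b - c]%classic).
  rewrite !lebesgue_measure_itv/= !lte_fin ltrD2r.
  by case: ifP => // _; rewrite -!EFinB opprB addrA subrK.
by apply/seteqP; split=> t /=; rewrite !in_itv/= ltrBlDr lerBrDr.
Qed.

Lemma negligible_shift (N : set R) (c : R) :
  mu.-negligible N -> mu.-negligible [set t | N (t + c)].
Proof.
move=> [A [mA A0 NA]]; exists [set t | A (t + c)]; split.
- have := measurable_funD (@measurable_id _ R setT) (@measurable_cst _ _ R R setT c).
  by move=> /(_ measurableT A mA); rewrite setTI.
- by have := lebesgue_measure_shift c mA; rewrite A0.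
- by move=> t; exact: NA.
Qed.

Lemma negligible_bigcup_int (N : int -> set R) :
  (forall m, mu.-negligible (N m)) -> mu.-negligible (\bigcup_m N m).
Proof.
move=> hN; pose F n := if unpickle n is Some m then N m else set0.
have : mu.-negligible (\bigcup_n F n).
  apply: negligible_bigcup => n; rewrite /F; case: unpickle => [m|].
    exact: hN.
  exact: negligible_set0.
apply: negligibleS => t [m _ Nt]; exists (pickle m); first by [].
by rewrite /F pickleK.
Qed.

Lemma mod_2pi_ge0 (x : R) :
  exists y (m : int), x = y + (pi *+ 2) *~ m /\ 0 <= y < pi *+ 2.
Proof.
have [y [m [-> /andP[y1 y2]]]] := mod_2pi x.
have pi0 := pi_gt0 R.
have [y0|y0] := leP 0 y.
  by exists y, m; split=> //; rewrite y0 mulr2n /=; lra.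
exists (y + pi *+ 2), (m - 1); split.
  by rewrite mulrzBr mulr1z; ring.
by rewrite mulr2n; apply/andP; split; lra.
Qed.

(** The exceptional set is covered by countably many translates of its part in one open period and
    of the null set of the end point 0. *)
Lemma ae_periodic (P : R -> Prop) :
  (forall t (m : int), P t -> P (t + (pi *+ 2) *~ m)) ->
  mu.-negligible [set t | `]0, pi *+ 2[%classic t /\ ~ P t] ->
  {ae mu, forall t, P t}.
Proof.
move=> pP nP.
pose N := [set t | `]0, pi *+ 2[%classic t /\ ~ P t] `|` [set 0].
have nN : mu.-negligible N.
  apply: negligibleU => //; exists [set 0]; split=> //.
  exact: lebesgue_measure_set1.
apply: negligibleS (negligible_bigcup_int
  (fun m : int => negligible_shift (- ((pi *+ 2) *~ m)) nN)).
move=> t /= nPt; have [y [m [tE /andP[y0 y2]]]] := mod_2pi_ge0 t.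
exists m => //=; rewrite tE addrK.
have [->|yn0] := eqVneq y 0; first by right.
left; split; first by rewrite /= in_itv/= lt0r yn0 y0.
by move=> Py; apply: nPt; rewrite tE; exact: pP.
Qed.

End Translation.

(** * Series dominated by [a / 2 ^ k] *)

Section GeometricSeries.
Context {R : realType}.
Variable a : R.
Hypothesis a0 : 0 < a.
Local Notation e k := (a / (2 ^ k)%:R).

Lemma halving_gt0 k : 0 < e k.
Proof. by rewrite divr_gt0// ltr0n expn_gt0. Qed.

Lemma halving_double k : e k.+1 *+ 2 = e k.
Proof.
rewrite expnS natrM mulr2n; field.
by rewrite pnatr_eq0 expn_eq0.
Qed.

Lemma halving_small (d : R) : 0 < d -> exists K, forall k, (K <= k)%N -> e k < d.
Proof.
move=> d0; exists (Num.trunc (a / d)).+1 => k Kk.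
rewrite ltr_pdivrMr ?ltr0n ?expn_gt0// mulrC -ltr_pdivrMr//.
apply: lt_le_trans (truncnS_gt _) _; rewrite ler_nat.
by apply: leq_trans Kk _; rewrite ltnW// ltn_expl.
Qed.

(** Subtracting [e n *+ 2] lets the induction close: each term uses up at most half of the remaining
    tail. *)
Lemma sum_halving_le (u : nat -> R) K n : (forall k, `|u k| <= e k) -> (K <= n)%N ->
  `|\sum_(0 <= k < n) u k - \sum_(0 <= k < K) u k| <= e K *+ 2 - e n *+ 2.
Proof.
move=> ue /subnK <-; move: (n - K)%N => m; elim: m => [|m IH].
  by rewrite add0n !subrr normr0.
rewrite addSn big_nat_recr//= addrAC (le_trans (ler_normD _ _))//.
have := ue (m + K)%N; have := halving_double (m + K); rewrite !mulr2n in IH *; lra.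
Qed.

(** Uniform convergence. The last clause transfers the periodicity of the terms to the sum. *)
Lemma series_limit (u : nat -> R -> R) :
  (forall k, continuous (u k)) -> (forall k t, `|u k t| <= e k) ->
  exists U : R -> R, [/\ continuous U,
    forall K t, `|U t - \sum_(0 <= k < K) u k t| <= e K *+ 2 &
    forall s t, (forall k, u k s = u k t) -> U s = U t].
Proof.
move=> cu ue; pose S t n := \sum_(0 <= k < n) u k t.
have cS t : cvgn (S t).
  apply: (@normed_cvg R R (fun k => u k t)).
  apply: (@series_le_cvg _ _ (geometric a 2^-1)) => [n|n|n|].
  - exact: normr_ge0.
  - by rewrite mulr_ge0 ?(ltW a0)// exprn_ge0.
  - by apply: le_trans (ue n t) _; rewrite /= exprVn natrX.
  - apply: is_cvg_geometric_series; rewrite ger0_norm//.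
    by rewrite invf_lt1// ltr1n.
pose U t : R := limn (S t).
have US K t : `|U t - S t K| <= e K *+ 2.
  have near_S n : (K <= n)%N -> `|S t n - S t K| <= e K *+ 2.
    move=> Kn; apply: le_trans (sum_halving_le (fun k => ue k t) Kn) _.
    by rewrite gerBl mulrn_wge0// ltW// halving_gt0.
  rewrite ler_distl; apply/andP; split.
    apply: limr_ge => //; exists K => // n /= /near_S.
    by rewrite ler_distl => /andP[].
  apply: limr_le => //; exists K => // n /= /near_S.
  by rewrite ler_distl => /andP[].
have cSK K : continuous (fun t => S t K).
  rewrite /S; elim: K => [|K IH].
    by under eq_fun do rewrite big_geq//; move=> t; exact: cvg_cst.
  by under eq_fun do rewrite big_nat_recr//=; exact: continuous_fctD.
exists U; split=> //; last first.
  by move=> s t st; rewrite /U /S; under eq_fun do under eq_bigr do rewrite st.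
move=> t; apply/cvgrPdist_lt => d d0.
(* Two tails of at most [e K *+ 2] and one difference of partial sums, with [e K < d / 5]. *)
have d5 : 0 < d / 5 by rewrite divr_gt0.
have [K eK] := halving_small d5; have {}eK := eK K (leqnn _).
have /cvgrPdist_lt/(_ _ d5) := cSK K t.
apply: filterS => s ts; have := US K t; have := US K s.
move: eK ts; rewrite !mulr2n !ler_distl !ltr_distl.
by move: (e K) (U s) (U t) (S s K) (S t K) => *; apply/andP; split; lra.
Qed.

Lemma complex_series_limit (h : nat -> R -> R[i]) :
  (forall k, ccont (h k)) -> (forall k, circle_fun (h k)) ->
  (forall k t, nm (h k t) <= e k) ->
  exists H : R -> R[i], [/\ ccont H, circle_fun H &
    forall K t, nm (H t - \sum_(0 <= k < K) h k t) <= e K *+ 4].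
Proof.
move=> ch ph he.
have [U [cU US Up]] := series_limit (fun k => (ch k).1)
  (fun k t => le_trans (nm_Re (h k t)) (he k t)).
have [V [cV VS Vp]] := series_limit (fun k => (ch k).2)
  (fun k t => le_trans (nm_Im (h k t)) (he k t)).
exists (fun t => Complex (U t) (V t)); split=> //.
  by move=> t; rewrite (Up (t + _) t) ?(Vp (t + _) t)// => k; rewrite ph.
have ReS K t : Re (\sum_(0 <= k < K) h k t) = \sum_(0 <= k < K) Re (h k t).
  by apply: (big_morph (@Re R)) => //; exact: ReD.
have ImS K t : Im (\sum_(0 <= k < K) h k t) = \sum_(0 <= k < K) Im (h k t).
  by apply: (big_morph (@Im R)) => //; exact: ImD.
move=> K t; apply: le_trans (nm_ReIm _) _.
rewrite ReD ReN ImD ImN ReS ImS /= (_ : 4 = 2 + 2)%N// mulrnDr.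
by apply: lerD; [exact: US|exact: VS].
Qed.

End GeometricSeries.

(** * The power series with blocks [P k] *)

Section BlockSeries.
Context {R : realType}.
Variables (P : nat -> {poly R[i]}) (N : nat -> nat).
Hypotheses (N_lt : forall k, (N k < N k.+1)%N)
  (P_low : forall k i, (i < N k)%N -> (P k)`_i = 0)
  (P_size : forall k, (size (P k) <= N k.+1)%N).

(** [P j] starts at [N j >= j], so that the indices up to [n] catch every coefficient of order
    [n]. *)
Definition block_coef n : R[i] := \sum_(0 <= j < n.+1) (P j)`_n.

Lemma N_mono j k : (j <= k)%N -> (N j <= N k)%N.
Proof.
move=> /subnK <-; elim: (k - j)%N => // m IH; rewrite addSn.
exact: leq_trans IH (ltnW (N_lt _)).
Qed.

Lemma N_ge k : (k <= N k)%N.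
Proof. by elim: k => // k IH; exact: leq_ltn_trans IH (N_lt k). Qed.

Lemma exists_block n : (N 0 <= n)%N -> exists K, (N K <= n < N K.+1)%N.
Proof.
move=> n0; suff [K] : exists K, (N K <= n)%N && (n < N K.+1)%N by exists K.
have [K nK] : exists K, (n < N K)%N by exists n.+1; exact: N_ge.
elim: K nK => [|K IH] nK; first by move: nK; rewrite ltnNge n0.
have [le_n|] := leqP (N K) n; first by exists K; rewrite le_n.
exact: IH.
Qed.

(** By [P_size] the blocks before [K] end below [n], and by [P_low] those after it start beyond
    [n]. *)
Lemma series_block K n t : (N K <= n < N K.+1)%N ->
  series (fun m => block_coef m * expi (m%:R * t)) n =
  \sum_(0 <= j < K) (P j).[expi t] + (take_poly n (P K)).[expi t].
Proof.
move=> /andP[Kn nK]; rewrite /series /=.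
transitivity (\sum_(0 <= m < n) \sum_(0 <= j < K.+1) (P j)`_m * expi t ^+ m).
  apply: eq_big_nat => m /andP[_ mn]; rewrite expiMn mulr_suml.
  have zero j l : (j <= l)%N -> (forall i, (j <= i)%N -> (P i)`_m = 0) ->
      \sum_(0 <= i < l) (P i)`_m * expi t ^+ m =
      \sum_(0 <= i < j) (P i)`_m * expi t ^+ m.
    move=> jl Pi0; rewrite (big_cat_nat (leq0n j) jl)/= [X in _ + X]big_nat_cond.
    rewrite [X in _ + X]big1 ?addr0// => i.
    by rewrite andbT => /andP[/Pi0 -> _]; rewrite mul0r.
  have z1 i : (m.+1 <= i)%N -> (P i)`_m = 0.
    by move=> mi; apply: P_low; exact: leq_trans mi (N_ge i).
  have z2 i : (K.+1 <= i)%N -> (P i)`_m = 0.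
    move=> Ki; apply: P_low; apply: leq_trans (N_mono Ki).
    exact: ltn_trans mn nK.
  rewrite -(zero m.+1 (maxn m.+1 K.+1))// ?leq_maxl// (zero K.+1)// leq_maxr//.
rewrite exchange_big_nat/=.
have takeE j : \sum_(0 <= m < n) (P j)`_m * expi t ^+ m =
    (take_poly n (P j)).[expi t].
  rewrite (horner_coef_wide _ (size_take_poly n (P j))) big_mkord.
  by apply: eq_bigr => m _; rewrite coef_take_poly ltn_ord.
under eq_bigr do rewrite takeE.
rewrite big_nat_recr//=; congr (_ + _); apply: eq_big_nat => j /andP[_ jK].
rewrite take_poly_id// (leq_trans (P_size j))// (leq_trans _ Kn)//.
exact: N_mono.
Qed.

End BlockSeries.

(** * Choice of all blocks and almost everywhere convergence of their series *)

Theorem theorem2 (R : realType) (f : R -> R[i]) (eps : R) :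
  L0 f -> 0 < eps ->
  exists g h : R -> R[i],
    [/\ PLA g, continuous_circle h, (supnorm h < eps%:E)%E &
        {ae (@lebesgue_measure R), forall t : R, f t = g t + h t}].
Proof.
move=> L0f eps0; have [pf _] := L0f.
pose D := [set` `](0 : R)%R, (pi *+ 2)%R[].
pose T := [set` `[(0 : R)%R, (pi *+ 2)%R]].
(* With 8, the sum of the [h k] is bounded by [4 * a = eps / 2], and three sets of measure at most
   [e k] by [eps / 2 ^ k.+1]. *)
pose a := eps / 8; have a0 : 0 < a by rewrite divr_gt0.
pose e k := a / (2 ^ k)%:R.
have e0 k : 0 < e k by exact: halving_gt0.
have [c cP] := choice (fun k => lusin_L0 L0f (e0 k)).
have [A AP] := choice cP; have {cP}cc k : ccont (c k) by have [] := AP k.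
have pc k : circle_fun (c k) by have [] := AP k.
have stepP (x : (R -> R[i]) * nat * nat) : exists y : {poly R[i]} * (R -> R[i]),
    let F := x.1.1 in let P := y.1 in let h := y.2 in
    ccont F -> circle_fun F ->
    [/\ forall i, (i < x.1.2)%N -> P`_i = 0,
    [/\ ccont h, circle_fun h & forall t, nm (h t) <= e x.2],
    (lebesgue_measure (T `&` [set t | (F t - P.[expi t] - h t)%R != 0%R]) <= (e x.2)%:E)%E &
    forall n t, F t = 0 -> nm (take_poly n P).[expi t] <= e x.2].
  have [[cF pF]|nF] := pselect (ccont x.1.1 /\ circle_fun x.1.1).
    by have [P [h Ph]] := residual_step x.1.2 cF pF (e0 x.2); exists (P, h).
  (* A dummy value: where the hypotheses on the residual fail, nothing is claimed. *)
  by exists (0, fun=> 0) => /= cF pF; case: nF.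
have [S SP] := choice stepP.
(* State: the residual and the first free frequency. Each step also passes from the target [c j] to
   [c j.+1]; the successor in [maxn] makes [N] strictly increasing. *)
pose st := fix st k : (R -> R[i]) * nat :=
  if k is j.+1 then
    let y := S (st j, j) in
    (fun t => (st j).1 t - y.1.[expi t] - y.2 t + (c j.+1 t - c j t),
     maxn (st j).2.+1 (size y.1))
  else (c 0%N, 0%N).
pose r k := (st k).1; pose N k := (st k).2.
pose P k := (S (st k, k)).1; pose h k := (S (st k, k)).2.
have rS k t : r k.+1 t = r k t - (P k).[expi t] - h k t + (c k.+1 t - c k t).
  by [].
have rP k : ccont (r k) /\ circle_fun (r k).
  elim: k => [|k [cr pr]]; first by split; [exact: cc|exact: pc].
  have [_ [ch ph _] _ _] := SP (st k, k) cr pr.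
  split.
    apply: ccontD; last exact: ccontB.
    by do 2!apply: ccontB => //; apply: ccont_trigpoly; exact: trigpoly_horner.
  have hp t : h k (t + pi *+ 2) = h k t := ph t.
  by move=> t; rewrite !rS pr expi_2pi !pc hp.
have spec k := SP (st k, k) (rP k).1 (rP k).2.
have N_lt k : (N k < N k.+1)%N by rewrite /N /= leq_max ltnSn.
have P_low k i : (i < N k)%N -> (P k)`_i = 0 by move: i; case: (spec k).
have P_size k : (size (P k) <= N k.+1)%N by rewrite /N /= leq_maxr.
have ch k : ccont (h k) by have [_ []] := spec k.
have ph k : circle_fun (h k) by have [_ []] := spec k.
have he k t : nm (h k t) <= e k by have [_ [_ _ hk] _ _] := spec k; exact: hk.
have takeP k n t : r k t = 0 -> nm (take_poly n (P k)).[expi t] <= e k.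
  by move: n t; case: (spec k).
have rE k t : r k t =
    c k t - \sum_(0 <= j < k) (P j).[expi t] - \sum_(0 <= j < k) h j t.
  elim: k => [|k IH]; first by rewrite !big_geq// !subr0.
  by rewrite rS IH !big_nat_recr//=; ring.
have [H [cH pH HS]] := complex_series_limit a0 ch ph he.
(* The decomposition then holds everywhere; what is to be shown is that [g] is in [PLA]. *)
pose g t := f t - H t.
have pg : circle_fun g by move=> t; rewrite /g pf pH.
exists g, H; split.
- split=> //; exists (block_coef P).
  apply: ae_periodic.
    move=> t m; rewrite (circle_funZ m t pg).
    have -> : (fun n => block_coef P n * expi (n%:R * (t + pi *+ 2 *~ m))) =
        (fun n => block_coef P n * expi (n%:R * t)).
      apply/funext => n; rewrite !expiMn.
      by rewrite (circle_funZ (F := @expi R) m t (@expi_2pi R)).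
    by [].
  (* Either the step leaves a residual, or [f] may differ from one of the two targets. *)
  pose E k := (T `&` [set t | (r k t - (P k).[expi t] - h k t)%R != 0%R]) `|`
    (A k `|` A k.+1).
  have mA k : measurable (A k) by have [] := AP k.
  have mT : measurable (T : set R) by exact: measurable_itv.
  have mB k : measurable (T `&`
      [set t | (r k t - (P k).[expi t] - h k t)%R != 0%R]).
    apply: measurableI => //.
    rewrite (_ : [set t | _] =
        [set t | 0 < nm (r k t - (P k).[expi t] - h k t)]).
      apply: measurable_gt; apply: ccont_nm; apply: ccontB => //.
      apply: ccontB; first by case: (rP k).
      by apply: ccont_trigpoly; exact: trigpoly_horner.
    by apply/seteqP; split=> t /=; rewrite lt0r nm_ge0 andbT nm_eq0.
  have mE k : measurable (E k).
    exact: (measurableU _ _ (mB k) (measurableU _ _ (mA k) (mA k.+1))).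
  have muE k : (lebesgue_measure (E k) <= (eps / (2 ^ k.+1)%:R)%:E)%E.
    have mu1 : (lebesgue_measure (T `&` [set t | (r k t - (P k).[expi t] - h k t)%R != 0%R])
        <= (e k)%:E)%E by case: (spec k).
    have mu2 : (lebesgue_measure (A k) <= (e k)%:E)%E by case: (AP k).
    have mu3 : (lebesgue_measure (A k.+1) <= (e k)%:E)%E.
      have [_ _ _ h3 _] := AP k.+1; apply: le_trans h3 _.
      have eh : e k.+1 *+ 2 = e k by exact: halving_double.
      by rewrite lee_fin -eh mulr2n lerDl ltW.
    apply: (@le_trans _ _ (e k + (e k + e k))%:E).
      apply: le_trans (measureU2 lebesgue_measure (mB k) (measurableU _ _ (mA k) (mA k.+1))) _.
      rewrite EFinD; apply: leeD => //.
      apply: le_trans (measureU2 lebesgue_measure (mA k) (mA k.+1)) _.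
      by rewrite EFinD; exact: leeD.
    rewrite lee_fin /e /a expnS natrM.
    have p0 : 0 < (2 ^ k)%:R :> R by rewrite ltr0n expn_gt0.
    rewrite -subr_ge0 (_ : _ - _ = eps / (2 ^ k)%:R / 8).
      by rewrite !divr_ge0// ltW.
    by field; rewrite gt_eqF.
  have E0 : lebesgue_measure (lim_sup_set E) = 0%E.
    apply: lim_sup_set_cvg0 => //.
    apply: (@le_lt_trans _ _ (eps%:E)); last exact: ltry.
    apply: le_trans (epsilon_trick0 xpredT (ltW eps0)).
    by apply: lee_nneseries => // k _; exact: muE.
  exists (lim_sup_set E); split=> //.
    apply: bigcap_measurable => // k _; apply: bigcup_measurable => j _.
    exact: mE.
  move=> t [Dt nP]; apply: contrapT => nE; apply: nP.
  have [K0 hK0] : exists K0, forall k, (K0 <= k)%N -> ~ E k t.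
    apply: contrapT => nK; apply: nE => n _; apply: contrapT => nEn.
    by apply: nK; exists n => k nk Ek; apply: nEn; exists k.
  have Tt : T t by apply: subset_itv_oo_cc.
  (* Both targets equal [f] at [t], so that replacing one by the other leaves the residual 0. *)
  have good k : (K0 <= k)%N -> f t = c k t /\ r k.+1 t = 0.
    move=> Kk; have nEk := hK0 k Kk.
    have fk : f t = c k t.
      by have [_ _ _ _] := AP k; apply=> // Ak; apply: nEk; right; left.
    have fk1 : f t = c k.+1 t.
      by have [_ _ _ _] := AP k.+1; apply=> // Ak; apply: nEk; right; right.
    split=> //; rewrite rS -fk -fk1 subrr addr0; apply/eqP.
    by apply: contrapT => /negP ne; apply: nEk; left.
  apply: nm_cvg => d d0.
  (* [4 * e K] for the tail of [H] and [e K] for the cut block. *)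
  have d5 : 0 < d / 5 by rewrite divr_gt0.
  have [K1 eK1] := halving_small a d5.
  (* [K0.+1], since the residual of index [K] vanishes by the step of index [K.-1]. *)
  pose K2 := maxn K0.+1 K1.
  exists (N K2) => n Nn.
  have [K KN] := exists_block N_lt (leq_trans (N_mono N_lt (leq0n K2)) Nn).
  have K2K : (K2 <= K)%N.
    rewrite leqNgt; apply/negP => KK2; have /andP[_] := KN.
    by rewrite ltnNge (leq_trans (N_mono N_lt KK2) Nn).
  rewrite (series_block N_lt P_low P_size t KN).
  have K0K : (K0 < K)%N by apply: leq_trans K2K; rewrite leq_maxl.
  have rK : r K t = 0.
    by move: K0K; case: (K) => // k; rewrite ltnS => /good[].
  have [fK _] := good K (ltnW K0K).
  (* As the residual is 0, the whole blocks add up exactly to [f] minus the first [h j]. *)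
  have := rE K t; rewrite rK -fK => /eqP; rewrite eq_sym subr_eq0 => /eqP fS.
  have -> : \sum_(0 <= j < K) (P j).[expi t] = f t - \sum_(0 <= j < K) h j t.
    by rewrite -fS; ring.
  rewrite (_ : _ - g t = (H t - \sum_(0 <= j < K) h j t) +
    (take_poly n (P K)).[expi t]); last by rewrite /g; ring.
  apply: le_lt_trans (nmD _ _) _.
  have := HS K t; have := takeP K n t rK.
  have := eK1 K (leq_trans (leq_maxr _ _) K2K).
  rewrite -/(e K) -mulr_natl => *; lra.
- by split=> //; exact: ccont_continuous.
- apply: (@le_lt_trans _ _ (eps / 2)%:E); last by rewrite lte_fin; lra.
  apply: ge_ereal_sup => _ [t _ <-]; rewrite lee_fin.
  (* The case [K = 0] of [HS] bounds [H] by [4 * a]. *)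
  have := HS 0%N t; rewrite big_geq// subr0 expn0 divr1 /a -mulr_natl; lra.
- by apply: aeW => t; rewrite /g subrK.
Qed.
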